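(* The semantic map on expressions is well defined: there is a unique function assigning to each expression $e$ and environment $\rho:\mathrm{Var}\to D(\mathbb{N}^{\Sigma^*})$ a measure $[\![ e]\!]\rho\in D(\mathbb{N}^{\Sigma^*})$ such that $[\![\mathsf{skip}]\!]\rho=\delta_{\{|\varepsilon|\}}$, $[\![\mathsf{fail}]\!]\rho=\delta_{\{||\}}$, $[\![ a]\!]\rho=\delta_{\{|a|\}}$ for $a\in\Sigma$, $[\![ x]\!]\rho=\rho(x)$, $[\![ e_1\oplus_r e_2]\!]\rho=r[\![ e_1]\!]\rho+(1-r)[\![ e_2]\!]\rho$, $[\![ e_1\& e_2]\!]\rho=[\![ e_1]\!]\rho\,\&\,[\![ e_2]\!]\rho$, $[\![ e_1;e_2]\!]\rho=[\![ e_1]\!]\rho\gg\!\!= -\cdot[\![ e_2]\!]\rho$, and $[\![\mathrm{fix}\,x.e]\!]\rho=[\![ e]\!]\rho[[\![\mathrm{fix}\,x.e]\!]\rho/x]$.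
   Context: $\Sigma$ is a finite alphabet, $\Sigma^*$ the finite strings, $\varepsilon$ the empty string. $\mathbb{N}^{\Sigma^*}$ is the set of functions $\alpha:\Sigma^*\to\mathbb{N}$ (multisets), $+$ pointwise sum. $\alpha\equiv_n\beta$ iff $\alpha(x)=\beta(x)$ for all strings of length $\le n$; $\mathbb{N}^{\Sigma^*}$ carries the $\sigma$-algebra generated by the classes $[\alpha]_n$; $D(\mathbb{N}^{\Sigma^*})$ is the set of probability measures, $\delta_\alpha$ Dirac. $\mu\&\nu=(\mu\otimes\nu)\circ(+)^{-1}$. For $x\in\Sigma^*$: $(x\cdot\alpha)(xy)=\alpha(y)$, $(x\cdot\alpha)(z)=0$ if $x$ is not a prefix of $z$; $x\cdot\nu=\nu\circ(x\cdot-)^{-1}$. For $\beta\in\mathbb{N}^{\Sigma^*}$, $\beta\cdot\nu$ is the law of $\sum_x\sum_{i=1}^{\beta(x)}X_{x,i}$ with independent $X_{x,i}\sim x\cdot\nu$; $(\mu\gg\!\!= -\cdot\nu)(A)=\int(\beta\cdot\nu)(A)\,d\mu(\beta)$. $\rho[\mu/x]$ is $\rho$ with $x$ rebound to $\mu$. Expressions over variables $\mathrm{Var}$ (disjoint from $\Sigma$): $e::= x\mid a\mid e_1\& e_2\mid e_1\oplus_r e_2\ (r\in[0,1])\mid e_1;e_2\mid\mathrm{fix}\,x.e\mid\mathsf{skip}\mid\mathsf{fail}$, subject to: in every $e_1;e_2$ the operand $e_1$ is closed (no free variables); in every $\mathrm{fix}\,x.e$ every path from the root of $e$ to a free occurrence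 of $x$ passes through some letter $a\in\Sigma$ (productivity). *)

(* Defs.v *)
From mathcomp Require Import all_boot all_order all_algebra.
From mathcomp Require Import all_classical all_reals all_analysis.

Set Implicit Arguments.
Unset Strict Implicit.
Unset Printing Implicit Defensive.
Import Order.TTheory GRing.Theory Num.Theory.
Local Open Scope classical_set_scope.
Local Open Scope ring_scope.

Section Multisets.
Variable Sigma : finType.

Definition multiset_eqn (n : nat) (alpha beta : seq Sigma -> nat) : Prop :=
  forall x, (size x <= n)%N -> alpha x = beta x.

Definition multiset_classes : set (set (seq Sigma -> nat)) :=
  [set B | exists n alpha, B = [set beta | multiset_eqn n alpha beta]].

(* Functions [seq Sigma -> nat] with the sigma-algebra generated by the
   classes of the relations [multiset_eqn n]. *)
Definition multiset := g_sigma_algebraType multiset_classes.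

Definition multiset_empty : multiset := fun _ => 0%N.
Definition multiset_single (x : seq Sigma) : multiset :=
  fun z => nat_of_bool (z == x).
Definition multiset_add (alpha beta : multiset) : multiset :=
  fun x => (alpha x + beta x)%N.
Definition multiset_prefix (x : seq Sigma) (alpha : multiset) : multiset :=
  fun z => if prefix x z then alpha (drop (size x) z) else 0%N.

End Multisets.

Section Measures.
Variables (R : realType) (Sigma : finType).
Local Notation M := (multiset Sigma).
Local Notation D := (probability M R).

(* A [probability] assigns values to all sets, including the non-measurable
   ones, so two elements of D(M) are equal when they agree on measurable
   sets. *)
Definition same_law (mu nu : set M -> \bar R) : Prop :=
  forall A, measurable A -> mu A = nu A.

(* mu & nu *)
Definition par_law (mu nu : D) : set M -> \bar R :=
  pushforward (mu \x nu)%E (fun p : M * M => multiset_add p.1 p.2).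

(* x . nu *)
Definition prefix_law (x : seq Sigma) (nu : D) : set M -> \bar R :=
  pushforward nu (fun alpha : M => multiset_prefix x alpha : M).

Definition choice_law (r : {i01 R}) (mu nu : D) : set M -> \bar R :=
  fun A => (r%:num%:E * mu A + (1 - r%:num)%:E * nu A)%E.

Definition mutually_independent d (Omega : measurableType d)
    (P : probability Omega R) (I : eqType) (X : I -> {RV P >-> M}) : Prop :=
  forall (s : seq I) (A : I -> set M), uniq s ->
    (forall i, measurable (A i)) ->
    P (\bigcap_(i in [set` s]) (X i @^-1` A i))
    = (\prod_(i <- s) P (X i @^-1` A i))%E.

(* [is_dot beta nu lambda]: lambda is the law beta . nu of the sum S of
   independent X_(x,i) ~ x . nu, where x ranges over all strings and i over
   beta(x) values.  The X_(x,i) are supported on multiples of x only almost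
   surely, so the infinite sum is finite only almost surely; it is taken in
   the extended reals. *)
Definition is_dot (beta : M) (nu lambda : D) : Prop :=
  exists (d : measure_display) (Omega : measurableType d)
         (P : probability Omega R)
         (X : {x : seq Sigma & 'I_(beta x)} -> {RV P >-> M})
         (S : {RV P >-> M}),
    [/\ forall k, same_law (distribution P (X k)) (prefix_law (tag k) nu),
        mutually_independent X,
        {ae P, forall omega, forall z : seq Sigma,
          ((S omega z)%:R%:E : \bar R)
          = (\esum_(k in [set: {x : seq Sigma & 'I_(beta x)}])
              ((X k omega z)%:R%:E : \bar R))%R} &
        same_law lambda (distribution P S)].

(* [is_bind mu nu lambda]: lambda is the law mu >>= (- . nu).  The kernel K is
   beta |-> beta . nu, determined up to [same_law] at each beta. *)
Definition is_bind (mu nu lambda : D) : Prop :=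
  exists K : M -> D,
    (forall beta, is_dot beta nu (K beta)) /\
    (forall A, measurable A -> lambda A = (\int[mu]_beta K beta A)%E).

End Measures.

Section Expressions.
Variables (R : realType) (Sigma : finType) (Var : eqType).

Inductive preexpr : Type :=
| Ref of Var
| Letter of Sigma
| Par of preexpr & preexpr
| Oplus of {i01 R} & preexpr & preexpr
| Seq of preexpr & preexpr
| Fix of Var & preexpr
| Skip
| Fail.

Fixpoint free_vars (e : preexpr) : seq Var :=
  match e with
  | Ref y => [:: y]
  | Par e1 e2 | Oplus _ e1 e2 | Seq e1 e2 => free_vars e1 ++ free_vars e2
  | Fix y e1 => [seq z <- free_vars e1 | z != y]
  | Letter _ | Skip | Fail => [::]
  end.

Definition closed_expr (e : preexpr) : bool := nilp (free_vars e).

(* A path follows one branch at & and at oplus_r, and in e1; e2 runs through e1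
   until it leaves e1 at a letter or at skip, then continues from the root of
   e2; it never leaves fail.  A path is represented by the letters it passes.
   Paths that reach a bound variable and re-enter the body of its fix are not
   listed: removing the detour only removes letters. *)
Fixpoint exit_paths (e : preexpr) : seq (seq Sigma) :=
  match e with
  | Ref _ | Fail => [::]
  | Letter a => [:: [:: a]]
  | Skip => [:: [::]]
  | Par e1 e2 | Oplus _ e1 e2 => exit_paths e1 ++ exit_paths e2
  | Seq e1 e2 => [seq u ++ v | u <- exit_paths e1, v <- exit_paths e2]
  | Fix _ e1 => exit_paths e1
  end.

(* Paths from the root of e to the free occurrences of x. *)
Fixpoint var_paths (x : Var) (e : preexpr) : seq (seq Sigma) :=
  match e with
  | Ref y => if y == x then [:: [::]] else [::]
  | Letter _ | Skip | Fail => [::]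
  | Par e1 e2 | Oplus _ e1 e2 => var_paths x e1 ++ var_paths x e2
  | Seq e1 e2 =>
      var_paths x e1 ++ [seq u ++ v | u <- exit_paths e1, v <- var_paths x e2]
  | Fix y e1 => if y == x then [::] else var_paths x e1
  end.

Definition productive_in (x : Var) (e : preexpr) : bool :=
  all (fun w => w != [::]) (var_paths x e).

Fixpoint well_formed (e : preexpr) : bool :=
  match e with
  | Ref _ | Letter _ | Skip | Fail => true
  | Par e1 e2 | Oplus _ e1 e2 => well_formed e1 && well_formed e2
  | Seq e1 e2 => [&& closed_expr e1, well_formed e1 & well_formed e2]
  | Fix x e1 => productive_in x e1 && well_formed e1
  end.

Definition expr := {e : preexpr | well_formed e}.

Definition env := Var -> probability (multiset Sigma) R.

Definition rebind (rho : env) (x : Var) (mu : probability (multiset Sigma) R)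
    : env :=
  fun y => if y == x then mu else rho y.

(* The first clause says that F is a function on environments valued in
   probability measures up to [same_law]. *)
Definition is_semantics (F : expr -> env -> probability (multiset Sigma) R)
    : Prop :=
  (forall e (rho rho' : env), (forall x, same_law (rho x) (rho' x)) ->
     same_law (F e rho) (F e rho')) /\
  forall rho : env,
  [/\ forall e : expr, val e = Skip ->
        same_law (F e rho) (\d_(multiset_single [::])),
      forall e : expr, val e = Fail ->
        same_law (F e rho) (\d_(@multiset_empty Sigma)),
      forall (e : expr) a, val e = Letter a ->
        same_law (F e rho) (\d_(multiset_single [:: a])) &
      forall (e : expr) x, val e = Ref x ->
        same_law (F e rho) (rho x)] /\
  [/\ forall (e e1 e2 : expr) r, val e = Oplus r (val e1) (val e2) ->
        same_law (F e rho) (choice_law r (F e1 rho) (F e2 rho)),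
      forall e e1 e2 : expr, val e = Par (val e1) (val e2) ->
        same_law (F e rho) (par_law (F e1 rho) (F e2 rho)),
      forall e e1 e2 : expr, val e = Seq (val e1) (val e2) ->
        is_bind (F e1 rho) (F e2 rho) (F e rho) &
      forall (e : expr) x (e1 : expr), val e = Fix x (val e1) ->
        same_law (F e rho) (F e1 (rebind rho x (F e rho)))].

End Expressions.

(* Main.v *)
(* Measures are compared level by level: two laws agree at level n when they
   coincide on the events that only look at strings shorter than n, and laws
   that agree at all levels are equal.  Every operation is nonexpansive for
   agreement, and composing with a closed e1 whose exit paths have length at
   least l gains l levels, because e1 then almost surely produces no string
   shorter than l.  Hence [[e]] rho agrees at level n as soon as, for each path w
   from the root of e to a free occurrence of y, the values rho y agree at level
   n - |w|.  By productivity the map mu |-> [[e]] rho[mu/x] gains one level, so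
   fix x.e has at most one value, and its iterates from a Dirac mass form a
   sequence of laws that stabilizes at each level.

   Such a sequence has a limit law: the masses of the cylinders of nat -> nat
   are consistent, so that they are the lengths of nested half-open intervals
   tiling [0, 1[ exactly, and reading off the branch of a Lebesgue-random point
   gives a random sequence with these cylinder masses.  The same limit theorem
   yields an infinite family of independent samples of nu, from which beta . nu
   is built. *)

From HB Require Import structures.
Require Import Defs.
From mathcomp Require Import all_boot all_order all_algebra.
From mathcomp Require Import all_classical all_reals all_analysis.
From mathcomp Require Import measurable_realfun.

Set Implicit Arguments.
Unset Strict Implicit.
Unset Printing Implicit Defensive.
Import Order.TTheory GRing.Theory Num.Theory.
Import numFieldNormedType.Exports.
Local Open Scope classical_set_scope.
Local Open Scope ring_scope.

(** * Measurability of multisets *)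

Section NatValued.
Context d (T : measurableType d).

Lemma measurable_fun_nat (f : T -> nat) :
  (forall n, measurable (f @^-1` [set n])) -> measurable_fun setT f.
Proof.
move=> mf _ B _; rewrite setTI.
have -> : f @^-1` B = \bigcup_(n in B) (f @^-1` [set n]).
  by apply/seteqP; split => [t Bt|t [n Bn /= ->]]; [exists (f t)|].
exact: bigcup_measurable.
Qed.

Lemma measurable_nat_preimage (f : T -> nat) (B : set nat) :
  measurable_fun setT f -> measurable (f @^-1` B).
Proof. by move=> mf; rewrite -[_ @^-1` _]setTI; apply: mf. Qed.

Lemma measurable_nat_index d' (T' : measurableType d')
    (f : T -> nat) (g : nat -> T -> T') :
  measurable_fun setT f -> (forall n, measurable_fun setT (g n)) ->
  measurable_fun setT (fun t => g (f t) t).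
Proof.
move=> mf mg _ B mB; rewrite setTI.
have -> : (fun t => g (f t) t) @^-1` B =
    \bigcup_n (f @^-1` [set n] `&` g n @^-1` B).
  by apply/seteqP; split => [t Bt|t [n _ /= [-> ]]]; [exists (f t)|].
apply: bigcup_measurable => n _; apply: measurableI.
  exact: measurable_nat_preimage.
by rewrite -[_ @^-1` _]setTI; apply: mg.
Qed.

Lemma measurable_nat_add (f g : T -> nat) :
  measurable_fun setT f -> measurable_fun setT g ->
  measurable_fun setT (fun t => f t + g t)%N.
Proof.
move=> mf mg; apply: (measurable_nat_index (g := fun n t => (n + g t)%N)) => // n.
exact: (measurableT_comp (f := fun m => (n + m)%N)).
Qed.

Lemma measurable_nat_sum (I : Type) (s : seq I) (f : I -> T -> nat) :
  (forall i, measurable_fun setT (f i)) ->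
  measurable_fun setT (fun t => \sum_(i <- s) f i t)%N.
Proof.
move=> mf; elim: s => [|i s IH].
  by under eq_fun do rewrite big_nil; exact: measurable_cst.
under eq_fun do rewrite big_cons; exact: measurable_nat_add.
Qed.

End NatValued.

Section Multiset.
Variable Sigma : finType.
Local Notation M := (multiset Sigma).
Implicit Types (a b : M) (n : nat).

Lemma measurable_class n a : measurable ([set b | multiset_eqn n a b] : set M).
Proof. by apply: sub_sigma_algebra; exists n, a. Qed.

Definition strings n : seq (seq Sigma) := [seq val t | t : n.-bseq Sigma].

Lemma mem_strings n x : (x \in strings n) = (size x <= n)%N.
Proof.
apply/mapP/idP => [[t _ ->]|xn]; first exact: size_bseq.
by exists (Bseq xn); rewrite ?mem_enum.
Qed.

(** A list of naturals codes a representative of each class at level [n]; lists being countable, so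
    are the classes, which makes evaluation at a string measurable. *)
Definition table n (s : seq nat) : M := fun z => nth 0%N s (index z (strings n)).

Lemma multiset_eqn_table n a : multiset_eqn n (table n (map a (strings n))) a.
Proof.
move=> x xn; rewrite /table (nth_map [::]) ?index_mem ?mem_strings//.
by rewrite nth_index ?mem_strings.
Qed.

Lemma measurable_eval (z : seq Sigma) : measurable_fun setT (fun a : M => a z).
Proof.
apply: measurable_fun_nat => c.
have -> : (fun a : M => a z) @^-1` [set c] =
    \bigcup_(s : seq nat) (if table (size z) s z == c
      then [set b | multiset_eqn (size z) (table (size z) s) b] else set0).
  apply/seteqP; split => [a /= az|a [s _]].
    exists (map a (strings (size z))) => //.
    by rewrite (multiset_eqn_table a (leqnn _)) az eqxx; exact: multiset_eqn_table.
  by case: eqP => //= <- /(_ z (leqnn _)).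
apply: countable_bigcupT_measurable => // s.
by case: ifP => _; [exact: measurable_class|exact: measurable0].
Qed.

Lemma measurable_multiset d (T : measurableType d) (f : T -> M) :
  (forall z, measurable_fun setT (fun t => f t z)) -> measurable_fun setT f.
Proof.
pose C : set (set M) := @multiset_classes Sigma.
move=> mf; apply: (@measurability _ _ T M setT f C) => //.
move=> _ [_ [n [a ->] <-]]; rewrite setTI.
have -> : f @^-1` [set b | multiset_eqn n a b] =
    \bigcap_(z in [set` strings n]) ((fun t => f t z) @^-1` [set a z]).
  apply/seteqP; split => [t /= ft z /=|t ft z zn].
    by rewrite mem_strings => /ft.
  by have /= -> := ft z; rewrite //= mem_strings.
rewrite bigcap_seq; apply: bigsetI_measurable => z _.
exact: measurable_nat_preimage.
Qed.

Lemma measurable_multiset_comp d (T : measurableType d) (f : T -> M) z :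
  measurable_fun setT f -> measurable_fun setT (fun t => f t z).
Proof. exact: measurableT_comp (measurable_eval z). Qed.

(** The bound is strict: [trunc 0] forgets everything, so level 0 carries no information, and
    [multiset_eqn n] corresponds to [trunc n.+1]. *)
Definition trunc n (a : M) : M := fun z => if (size z < n)%N then a z else 0%N.

Lemma trunc_trunc n m a : (n <= m)%N -> trunc n (trunc m a) = trunc n a.
Proof.
move=> nm; apply/funext => z; rewrite /trunc; case: ifP => // zn.
by rewrite (leq_trans zn nm).
Qed.

Lemma measurable_trunc n : measurable_fun setT (trunc n).
Proof.
apply: measurable_multiset => z; rewrite /trunc; case: (size z < n)%N.
  exact: measurable_eval.
exact: measurable_cst.
Qed.

Lemma measurable_add d (T : measurableType d) (f g : T -> M) :
  measurable_fun setT f -> measurable_fun setT g ->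
  measurable_fun setT (fun t => multiset_add (f t) (g t)).
Proof.
move=> mf mg; apply: measurable_multiset => z.
by apply: measurable_nat_add; exact: measurable_multiset_comp.
Qed.

Lemma measurable_prefix x : measurable_fun setT (multiset_prefix x : M -> M).
Proof.
apply: measurable_multiset => z; rewrite /multiset_prefix; case: (prefix x z).
  exact: measurable_eval.
exact: measurable_cst.
Qed.

Lemma trunc_add n a b :
  trunc n (multiset_add a b) = multiset_add (trunc n a) (trunc n b).
Proof. by apply/funext => z; rewrite /trunc /multiset_add; case: ifP. Qed.

(** Prepending [x] lengthens every string by [size x]. When [n <= size x] the truncated difference
    is 0 and both sides are empty. *)
Lemma trunc_prefix n x a :
  trunc n (multiset_prefix x a) = trunc n (multiset_prefix x (trunc (n - size x) a)).
Proof.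
apply/funext => z; rewrite /trunc /multiset_prefix; case: ifP => // zn.
case: ifP => // /prefixP[y zxy]; rewrite zxy size_drop size_cat addKn.
by move: zn; rewrite zxy size_cat ltn_subRL => ->.
Qed.

Lemma trunc_eqP n a b : multiset_eqn n a b <-> trunc n.+1 a = trunc n.+1 b.
Proof.
split => [ab|ab z zn].
  by apply/funext => z; rewrite /trunc ltnS; case: ifP => // /ab.
by have := congr1 (fun f : M => f z) ab; rewrite /trunc ltnS zn.
Qed.

End Multiset.

(** * Agreement of laws level by level *)

Section Agreement.
Variables (R : realType) (Sigma : finType).
Local Notation M := (multiset Sigma).
Local Notation D := (probability M R).

Lemma measurableT_preimage d d' (T : measurableType d) (T' : measurableType d')
    (f : T -> T') A :
  measurable_fun setT f -> measurable A -> measurable (f @^-1` A).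
Proof. by move=> mf mA; rewrite -[_ @^-1` _]setTI; exact: mf. Qed.

Lemma preimage_trunc_measurable n (A : set M) :
  measurable A -> measurable (@trunc Sigma n @^-1` A).
Proof. by apply: measurableT_preimage; exact: measurable_trunc. Qed.

(* Equality of mu and nu on the sigma-algebra generated by the multiplicities
   of the strings of length less than n. *)
Definition agree n (mu nu : set M -> \bar R) : Prop :=
  forall A, measurable A -> mu (trunc n @^-1` A) = nu (trunc n @^-1` A).

Lemma same_law_agree n (mu nu : set M -> \bar R) : same_law mu nu -> agree n mu nu.
Proof. by move=> h A mA; apply: h; exact: preimage_trunc_measurable. Qed.

Lemma agree_refl n (mu : set M -> \bar R) : agree n mu mu. Proof. by []. Qed.

Lemma agree_sym n (mu nu : set M -> \bar R) : agree n mu nu -> agree n nu mu.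
Proof. by move=> h A /h. Qed.

Lemma agree_trans n (mu nu la : set M -> \bar R) :
  agree n mu nu -> agree n nu la -> agree n mu la.
Proof. by move=> h1 h2 A mA; rewrite h1// h2. Qed.

Lemma preimage_trunc_trunc n m (A : set M) : (n <= m)%N ->
  @trunc Sigma m @^-1` (trunc n @^-1` A) = trunc n @^-1` A.
Proof.
by move=> nm; apply/seteqP; split => a /=; rewrite trunc_trunc.
Qed.

Lemma agree_le n m (mu nu : set M -> \bar R) : (n <= m)%N -> agree m mu nu -> agree n mu nu.
Proof.
move=> nm h A mA; have := h _ (preimage_trunc_measurable n mA).
by rewrite preimage_trunc_trunc.
Qed.

Lemma agree0 (mu nu : D) : agree 0 mu nu.
Proof.
move=> A mA; have [A0|A0] := pselect (A (@multiset_empty Sigma)).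
  have -> : trunc 0 @^-1` A = setT by apply/seteqP; split.
  by rewrite !probability_setT.
have -> : trunc 0 @^-1` A = set0 by apply/seteqP; split.
by rewrite !measure0.
Qed.

(** Two classes are nested or disjoint; with [set0] and the full set added, the classes form a
    generating pi-system, to which uniqueness of measures applies. *)
Lemma agree_same_law (mu nu : D) : (forall n, agree n mu nu) -> same_law mu nu.
Proof.
move=> h; pose G : set (set M) := @multiset_classes Sigma `|` [set set0; [set: M]].
have mG : @measurable _ M = <<s G >>.
  apply/seteqP; split; apply: smallest_sub.
  + exact: smallest_sigma_algebra.
  + by move=> A CA; apply: sub_sigma_algebra; left.
  + exact: sigma_algebra_measurable.
  + by move=> A [CA|[->|->]];
      [exact: sub_sigma_algebra|exact: measurable0|exact: measurableT].
have IG : setI_closed G.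
  have cl (A B : set M) : multiset_classes A -> multiset_classes B -> G (A `&` B).
    have aux n m (a b : M) : (n <= m)%N ->
        G ([set c | multiset_eqn n a c] `&` [set c | multiset_eqn m b c]).
      move=> nm; have [ab|ab] := pselect (multiset_eqn n a b).
        left; exists m, b; apply/seteqP; split => [c []//|c bc]; split => // x xn.
        by rewrite (ab x xn); apply: bc; exact: leq_trans nm.
      right; left; apply/seteqP; split => // c [ac bc]; apply: ab => x xn.
      by rewrite (ac x xn) (bc x (leq_trans xn nm)).
    move=> [n [a ->]] [m [b ->]].
    have [nm|/ltnW nm] := leqP n m; first exact: aux.
    by rewrite setIC; exact: aux.
  by move=> A B [CA|[->|->]] [CB|[->|->]]; rewrite ?setI0 ?set0I ?setIT ?setTI;
    by [exact: cl|left|right; left|right; right].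
apply: (@measure_unique _ R M G (fun=> setT) mG IG) => //.
- by move=> _; right; right.
- by rewrite bigcup_const.
- move=> A [[n [a ->]]|[->|->]]; last 2 first.
  + by rewrite !measure0.
  + exact: etrans (probability_setT mu) (esym (probability_setT nu)).
  have -> : [set b | multiset_eqn n a b] =
      trunc n.+1 @^-1` [set b | multiset_eqn n a b].
    by apply/seteqP; split => b /= /trunc_eqP h1; apply/trunc_eqP;
      rewrite h1 trunc_trunc.
  exact: (h n.+1 _ (measurable_class n a)).
- by move=> _; apply: le_lt_trans (probability_le1 mu measurableT) _; rewrite ltry.
Qed.

End Agreement.

(** * Limits of consistent probabilities *)

Lemma probability_of_measure d (T : measurableType d) (R : realType)
    (m : {measure set T -> \bar R}) :
  m setT = 1%E -> exists P : probability T R, forall A, P A = m A.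
Proof.
move=> m1; pose P0 : set T -> \bar R := m.
pose mP := isMeasure.Build _ T R P0 (measure0 m) (measure_ge0 m)
  (@measure_semi_sigma_additive _ _ _ m).
pose M0 : {measure set T -> \bar R} := HB.pack P0 mP.
pose pP := Measure_isProbability.Build _ T R M0 m1.
pose Q : probability T R := HB.pack P0 M0 pP.
by exists Q.
Qed.

Lemma pushforward_probability d d' (T : measurableType d) (T' : measurableType d')
    (R : realType) (m : {measure set T -> \bar R}) (f : T -> T') :
  measurable_fun setT f -> m setT = 1%E ->
  exists P : probability T' R, forall A, P A = m (f @^-1` A).
Proof.
move=> mf m1; pose p : set T' -> \bar R := pushforward m f.
pose mp := measure_function_pushforward__canonical__measure_function_Measure.
have [|P PE] := @probability_of_measure _ _ _ (mp _ _ _ _ R m f mf); last by exists P.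
by rewrite /= /pushforward preimage_setT.
Qed.

(** * A random branch with prescribed cylinder masses *)

Section Tree.
Variables (R : realType) (W : seq nat -> R).
Hypothesis W_ge0 : forall s, 0 <= W s.
Hypothesis W_nil : W [::] = 1.
Hypothesis W_sum : forall s,
  (fun n => \sum_(m < n) W (rcons s (m : nat))) @ \oo --> W s.

Local Notation partial s n := (\sum_(m < n) W (rcons s (m : nat))).
Implicit Types s : seq nat.

Lemma partial_le s m n : (m <= n)%N -> partial s m <= partial s n.
Proof.
move=> mn; rewrite -!(big_mkord xpredT (fun i => W (rcons s i))).
by rewrite (big_cat_nat (leq0n m) mn) /= lerDl sumr_ge0.
Qed.

Lemma partial_leW s n : partial s n <= W s.
Proof.
have cv : cvgn (fun n => partial s n) by apply/cvg_ex; exists (W s); exact: (@W_sum s).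
rewrite -(cvg_lim _ (@W_sum s))//.
exact: (nondecreasing_cvgn_le (partial_le s) cv).
Qed.

Lemma partial_gt s y : y < W s -> exists n, y < partial s n.
Proof.
move=> yW; have := @W_sum s.
move/cvgr_gt => /(_ _ yW) [n _ /(_ n (leqnn _)) ?]; by exists n.
Qed.

(** Recursion on the reversed word, since children are formed with [rcons]: child [n] starts after
    the total length of its siblings of smaller rank. *)
Fixpoint left_end_rev (r : seq nat) : R :=
  if r is n :: r' then left_end_rev r' + partial (rev r') n else 0.

Definition left_end s := left_end_rev (rev s).

Lemma left_end_rcons s n : left_end (rcons s n) = left_end s + partial s n.
Proof. by rewrite /left_end rev_rcons /= revK. Qed.

(* The half-open intervals of the children of s tile that of s exactly. *)
Definition node s : set R := `[left_end s, left_end s + W s[.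

Lemma nodeE s t : node s t <-> left_end s <= t < left_end s + W s.
Proof. by rewrite /node /= in_itv. Qed.

Lemma node_child s n : node (rcons s n) `<=` node s.
Proof.
move=> t /nodeE; rewrite left_end_rcons => /andP[lt tl]; apply/nodeE/andP; split.
  by apply: le_trans lt; rewrite lerDl sumr_ge0.
apply: lt_le_trans tl _; rewrite -addrA lerD2l.
by have := partial_leW s n.+1; rewrite big_ord_recr.
Qed.

(** The partial sums tend to [W s] and [t] lies strictly before the right end, so finitely many
    children already reach beyond [t]. *)
Lemma node_cover s t : node s t -> exists n, node (rcons s n) t.
Proof.
move=> /nodeE/andP[lt tl].
have ex : exists n, t - left_end s < partial s n.
  by apply: partial_gt; rewrite ltrBlDl.
(* The least such number is some [n.+1] and selects child [n]; it cannot be 0, as the empty sum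
   would put [t] left of the interval. *)
have [[|n] tn nmin] := ex_minnP ex.
  by move: tn; rewrite big_ord0 subr_lt0 ltNge lt.
exists n; apply/nodeE; rewrite left_end_rcons -lerBrDl -addrA -ltrBlDl.
move: tn; rewrite big_ord_recr /= => ->; rewrite andbT leNgt.
by apply/negP => /nmin; rewrite ltnn.
Qed.

Lemma node_disjoint s n n' t : node (rcons s n) t -> node (rcons s n') t -> n = n'.
Proof.
have aux m m' : (m < m')%N -> node (rcons s m) t -> ~ node (rcons s m') t.
  move=> mm' /nodeE /andP[_]; rewrite left_end_rcons -addrA => lt /nodeE/andP[].
  rewrite left_end_rcons => lt' _; move: lt; apply/negP; rewrite -leNgt.
  apply: le_trans lt'; rewrite lerD2l.
  by have := partial_le s mm'; rewrite big_ord_recr.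
move=> h h'; have [mm|mm|//] := ltngtP n n'; first by have := aux _ _ mm h.
by have := aux _ _ mm h'.
Qed.

(** The default 0 of [xget] is used only for points outside the root interval, whose branch is
    constantly 0. *)
Fixpoint branch (t : R) (k : nat) : seq nat :=
  if k is k'.+1 then
    let s := branch t k' in rcons s (xget 0%N [set n | node (rcons s n) t])
  else [::].

Lemma size_branch t k : size (branch t k) = k.
Proof. by elim: k => //= k IH; rewrite size_rcons IH. Qed.

Lemma node_branch t k : node [::] t -> node (branch t k) t.
Proof.
move=> t0; elim: k => //= k /node_cover[n nt].
exact: (@xgetI _ 0%N [set m | node (rcons (branch t k) m) t] n).
Qed.

Lemma branch_node s t : node s t -> branch t (size s) = s.
Proof.
elim/last_ind: s => // s n IH nt; rewrite size_rcons /= (IH (node_child nt)).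
congr rcons; apply: xget_unique => // m mt; exact: node_disjoint mt nt.
Qed.

Lemma node_root s t : node s t -> node [::] t.
Proof. by elim/last_ind: s => // s n IH /node_child /IH. Qed.

Lemma nth_branch t k j : (j < k)%N -> nth 0%N (branch t k) j = nth 0%N (branch t j.+1) j.
Proof.
elim: k => // k IH; rewrite ltnS leq_eqVlt => /orP[/eqP -> //|jk].
by rewrite -IH //= nth_rcons size_branch jk.
Qed.

(* multiset unit plays the role of nat -> nat: seq unit is a copy of nat
   through size. *)
Definition branch_point (t : R) : multiset unit :=
  fun x => nth 0%N (branch t (size x).+1) (size x).

Definition cylinder (s : seq nat) : set (multiset unit) :=
  [set w | forall x : seq unit, (size x < size s)%N -> w x = nth 0%N s (size x)].

(** Intersecting with the root interval discards the points whose branch is 0 by default. *)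
Lemma branch_point_cylinder s : branch_point @^-1` cylinder s `&` node [::] = node s.
Proof.
apply/seteqP; split => [t [st t0]|t st].
  suff <- : branch t (size s) = s by exact: node_branch.
  apply: (@eq_from_nth _ 0%N); rewrite size_branch// => i ilt.
  by have := st (nseq i tt); rewrite /branch_point size_nseq nth_branch// => ->.
split; last exact: node_root st.
by move=> x xs; rewrite /branch_point -(nth_branch _ xs) branch_node.
Qed.

Lemma measurable_branch_point :
  measurable_fun setT (branch_point : measurableTypeR R -> multiset unit).
Proof.
apply: measurable_multiset => x; apply: measurable_fun_nat => c.
have -> : (fun t => branch_point t x) @^-1` [set c] =
   (\bigcup_(s : seq nat) (if (size s == (size x).+1) && (nth 0%N s (size x) == c)
     then node s else set0)) `|` (if c == 0%N then ~` node [::] else set0).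
  apply/seteqP; split => [t /= tc|t [[s _]|]].
  - have [t0|t0] := pselect (node [::] t).
      left; exists (branch t (size x).+1) => //.
      move: tc; rewrite /branch_point => ->.
      by rewrite size_branch !eqxx; exact: node_branch.
    right; rewrite -tc /branch_point /= nth_rcons size_branch ltnn eqxx.
    by rewrite xgetPN// => n /node_root.
  - by case: ifP => //= /andP[/eqP sx /eqP <-] /branch_node; rewrite sx /branch_point => ->.
  - case: eqP => //= -> t0; rewrite /branch_point /= nth_rcons size_branch ltnn eqxx.
    by rewrite xgetPN// => n /node_root.
have mnode s : measurable (node s : set (measurableTypeR R)) by exact: measurable_itv.
apply: measurableU.
  apply: countable_bigcupT_measurable => [|s]; [exact: countableP|].
  by case: ifP => _; [exact: mnode|exact: measurable0].
case: ifP => _; last exact: measurable0.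
by apply: measurableC; exact: mnode.
Qed.

Lemma tree_probability : exists P : probability (multiset unit) R,
  forall s, P (cylinder s) = (W s)%:E.
Proof.
have mnode s : measurable (node s : set (measurableTypeR R)) by exact: measurable_itv.
have len s : lebesgue_measure (node s : set (measurableTypeR R)) = (W s)%:E.
  rewrite lebesgue_measure_itv /= lte_fin ltrDl.
  have := W_ge0 s; rewrite le_eqVlt => /orP[/eqP <-|->]; first by rewrite ltxx.
  by rewrite -EFinD addrC addKr.
pose m := @mrestr _ (measurableTypeR R) R _ (@lebesgue_measure R) (mnode [::]).
have [|P PE] := @pushforward_probability _ _ _ _ _
    m _ measurable_branch_point.
  by rewrite /m/= /mrestr setTI len W_nil.
exists P => s; rewrite PE -len.
by congr (lebesgue_measure _); exact: branch_point_cylinder.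
Qed.

End Tree.

(** * Limits of laws of sequences *)

Section Cylinders.
Variable R : realType.
Local Notation N := (multiset unit).
Local Notation D := (probability N R).
Implicit Type s : seq nat.

Lemma cylinder_trunc s : trunc (size s) @^-1` cylinder s = cylinder s.
Proof.
by apply/seteqP; split => w h x xs; have := h x xs; rewrite /trunc xs.
Qed.

Lemma measurable_cylinder s : measurable (cylinder s).
Proof.
(* For the empty word, [(size s).-1] is still 0 and the empty string remains listed; the test then
   leaves it unconstrained. *)
have -> : cylinder s = \bigcap_(x in [set` strings unit (size s).-1])
    (if (size x < size s)%N then (fun w : N => w x) @^-1` [set nth 0%N s (size x)]
     else setT).
  apply/seteqP; split => [w h x _|w h x xs]; first by case: ifP => // /h.
  have := h x; rewrite xs; apply; rewrite /= mem_strings -ltnS.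
  exact: leq_trans xs (leqSpred _).
rewrite bigcap_seq; apply: bigsetI_measurable => x _; case: ifP => // _.
by apply: measurable_nat_preimage; exact: measurable_eval.
Qed.

Lemma cylinder_rcons s : cylinder s = \bigcup_n cylinder (rcons s n).
Proof.
apply/seteqP; split => [w h|w [n _ h] x xs].
  exists (w (nseq (size s) tt)) => // x; rewrite size_rcons ltnS leq_eqVlt nth_rcons.
  case: ltngtP => //= [xs _|xs _]; first exact: h.
  by congr w; rewrite -xs; elim: x {xs} => //= -[] x {1}->.
rewrite h ?nth_rcons ?xs ?size_rcons ?ltnS ?(ltnW xs)//. 
Qed.

Lemma cylinder_eq s s' w : size s = size s' -> cylinder s w -> cylinder s' w -> s = s'.
Proof.
move=> ss h h'; apply: (@eq_from_nth _ 0%N) => // i ilt.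
by rewrite -(size_nseq i tt) -h ?size_nseq// h' ?size_nseq -?ss.
Qed.

Lemma trivIset_cylinder s : trivIset setT (fun n => cylinder (rcons s n)).
Proof.
move=> n m _ _ [w [h h']].
have /rcons_inj[//] : rcons s n = rcons s m by apply: cylinder_eq h h'; rewrite !size_rcons.
Qed.

(** An event of level [n] is a countable disjoint union of cylinders over words of length [n], to
    which sigma-additivity applies. *)
Lemma agree_cylinder n (mu nu : D) :
  (forall s, size s = n -> mu (cylinder s) = nu (cylinder s)) -> agree n mu nu.
Proof.
move=> h A mA; pose word s : N := fun x => nth 0%N s (size x).
(* [pickle_inv] gives each word a single index, so that distinct indices yield disjoint sets. *)
pose F i := if pickle_inv i is Some s then
  if (size s == n) && `[< A (word s) >] then cylinder s else set0 else set0.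
have -> : trunc n @^-1` A = \bigcup_i F i.
  apply/seteqP; split => [w /= Aw|w [i _]]; rewrite /F.
    pose s := [seq w (nseq i tt) | i <- iota 0 n].
    have sn : size s = n by rewrite size_map size_iota.
    have E x : (size x < n)%N -> nth 0%N s (size x) = w x.
      move=> xn; rewrite (nth_map 0%N) ?size_iota// nth_iota//.
      by congr w; rewrite add0n; elim: x {xn} => //= -[] x ->.
    exists (pickle s) => //; rewrite pickleK_inv sn eqxx /=.
    have -> : word s = trunc n w.
      apply/funext => x; rewrite /word /trunc; case: ltnP => [/E//|nx].
      by rewrite nth_default// sn.
    by rewrite (asboolT Aw) => x; rewrite sn => /E.
  case: pickle_inv => // s; case: ifP => // /andP[/eqP sn /asboolP As] ws /=.
  suff <- : word s = trunc n w by [].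
  apply/funext => x; rewrite /word /trunc; case: ltnP => xn; first by rewrite ws ?sn.
  by rewrite nth_default// sn.
have mF i : measurable (F i).
  rewrite /F; case: pickle_inv => [s|]; last exact: measurable0.
  by case: ifP => _; [exact: measurable_cylinder|exact: measurable0].
have tF : trivIset setT F.
  move=> i j _ _ [w []]; rewrite /F.
  have := @pickle_invK (seq nat) i; case: (pickle_inv i) => [s|//] /= <-.
  case: ifP => // /andP[/eqP sn _] ws.
  have := @pickle_invK (seq nat) j; case: (pickle_inv j) => [s'|//] /= <-.
  case: ifP => // /andP[/eqP s'n _] ws'.
  by congr pickle; apply: cylinder_eq ws ws'; rewrite sn.
rewrite !measure_bigcup//; apply: eq_eseriesr => i _.
rewrite /F; case: pickle_inv => [s|]; last by rewrite !measure0.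
by case: ifP => [/andP[/eqP sn _]|_]; [exact: h|rewrite !measure0].
Qed.

Lemma agree_chain (Sigma : finType) (mu : nat -> probability (multiset Sigma) R) :
  (forall k, agree k (mu k) (mu k.+1)) ->
  forall k m, (k <= m)%N -> agree k (mu k) (mu m).
Proof.
move=> h k m; elim: m => [|m IH]; first by rewrite leqn0 => /eqP ->.
rewrite leq_eqVlt ltnS => /orP[/eqP -> //|km].
by apply: (agree_trans (IH km)); apply: (agree_le km); exact: h.
Qed.

Lemma limit_probability_unit (mu : nat -> D) :
  (forall k, agree k (mu k) (mu k.+1)) ->
  exists P : D, forall k, agree k P (mu k).
Proof.
move=> h; pose W s := fine (mu (size s) (cylinder s)).
have WE s : (W s)%:E = mu (size s) (cylinder s).
  by rewrite fineK// fin_num_measure//; exact: measurable_cylinder.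
have [|||P PE] := @tree_probability _ W.
- by move=> s; exact: fine_ge0.
- rewrite /W (_ : cylinder [::] = setT); last by apply/seteqP; split.
  by rewrite [X in fine X](probability_setT (mu 0%N)).
- move=> s.
  have cv : (fun n => \sum_(0 <= i < n) mu (size s).+1 (cylinder (rcons s i)))%E @ \oo
      --> (W s)%:E.
    (* Agreement of consecutive laws moves the mass of [cylinder s] to the law in which its children
       are weighed, where sigma-additivity sums them. *)
    have -> : (W s)%:E = mu (size s).+1 (\bigcup_n cylinder (rcons s n)).
      rewrite -cylinder_rcons WE -cylinder_trunc.
      by apply: h; exact: measurable_cylinder.
    apply: measure_sigma_additive; last exact: trivIset_cylinder.
    by move=> n; exact: measurable_cylinder.
  move/fine_cvgP : cv => [_ cv]; apply: cvg_trans cv; apply: near_eq_cvg; near=> n.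
  rewrite /= big_mkord (eq_bigr (fun i : 'I_n => (W (rcons s i))%:E)) ?sumEFin// => i _.
  by rewrite WE size_rcons.
exists P => k; apply: agree_cylinder => s <-.
by rewrite PE WE.
Unshelve. all: by end_near. Qed.

End Cylinders.

(** * Limits of laws of multisets of strings *)

Section Limit.
Variables (R : realType) (Sigma : finType).
Local Notation M := (multiset Sigma).
Local Notation D := (probability M R).

(** Strings are numbered by [pickle], which turns multisets of strings into sequences; when
    encoding, an index that numbers no string receives 0. *)
Definition decode (w : multiset unit) : M := fun z => w (nseq (pickle z) tt).

Definition encode (a : M) : multiset unit :=
  fun x => if (unpickle (size x) : option (seq Sigma)) is Some z then a z else 0%N.

Lemma encodeK a : decode (encode a) = a.
Proof. by apply/funext => z; rewrite /decode /encode size_nseq pickleK. Qed.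

Lemma measurable_decode : measurable_fun setT decode.
Proof. by apply: measurable_multiset => z; exact: measurable_eval. Qed.

Lemma measurable_encode : measurable_fun setT encode.
Proof.
apply: measurable_multiset => x; rewrite /encode; case: unpickle => [z|].
  exact: measurable_eval.
exact: measurable_cst.
Qed.

Lemma limit_probability (mu : nat -> D) :
  (forall k, agree k (mu k) (mu k.+1)) ->
  exists P : D, forall k, agree k P (mu k).
Proof.
move=> h.
(* [F j] is a level at which entry [j] of an encoding is visible, and [c n] one at which the first
   [n] entries are; [n <= c n] makes these levels unbounded. *)
pose F j := if (unpickle j : option (seq Sigma)) is Some z then (size z).+1 else 0%N.
pose c n : nat := maxn n (\max_(j < n) F j)%N.
have c_mono n m : (n <= m)%N -> (c n <= c m)%N.
  move=> nm; rewrite /c geq_max leq_max nm /= leq_max; apply/orP; right.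
  apply/bigmax_leqP => i _.
  exact: (leq_bigmax (F := fun j : 'I_m => F j) (widen_ord nm i)).
have /choice[nu nuE] n : exists P : probability (multiset unit) R,
    forall A, P A = mu (c n) (encode @^-1` A).
  by apply: pushforward_probability; [exact: measurable_encode|exact: probability_setT].
have encode_trunc n a : trunc n (encode a) = trunc n (encode (trunc (c n) a)).
  apply/funext => x; rewrite /trunc; case: ltnP => // xn; rewrite /encode.
  case E: (unpickle (size x)) => [z|//]; rewrite ifT//.
  rewrite /c leq_max; apply/orP; right.
  apply: leq_trans (leq_bigmax (F := fun j : 'I_n => F j) (Ordinal xn)).
  by rewrite /F [unpickle _]E.
have mtr n A : measurable A -> measurable (encode @^-1` (@trunc unit n @^-1` A)).
  move=> mA; apply: measurableT_preimage; first exact: measurable_encode.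
  exact: preimage_trunc_measurable.
have [|P PE] := @limit_probability_unit R nu.
  move=> k A mA; rewrite !nuE.
  have -> : encode @^-1` (trunc k @^-1` A) =
     trunc (c k) @^-1` (encode @^-1` (trunc k @^-1` A)).
    by apply/seteqP; split => a /=; rewrite -encode_trunc.
  by apply: agree_chain => //; [exact: c_mono|exact: mtr].
have [Q QE] := @pushforward_probability _ _ _ _ _ P _ measurable_decode (probability_setT _).
exists Q => k A mA; rewrite QE.
(* The codes of all strings shorter than [k] are below [n], so the first [n] entries determine the
   decoded multiset at level [k]; also [k <= n <= c n]. *)
pose n := maxn k (\max_(z <- strings Sigma k) (pickle z).+1)%N.
have nz (z : seq Sigma) : (size z < k)%N -> (pickle z < n)%N.
  move=> zk; rewrite /n leq_max; apply/orP; right.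
  apply: (leq_bigmax_seq (F := fun z : seq Sigma => (pickle z).+1)) => //.
  by rewrite mem_strings ltnW.
have decode_trunc w : trunc k (decode w) = trunc k (decode (trunc n w)).
  apply/funext => z; rewrite /trunc; case: ltnP => // zk.
  by rewrite /decode size_nseq nz.
have E : decode @^-1` (trunc k @^-1` A) =
    trunc n @^-1` (decode @^-1` (trunc k @^-1` A)).
  by apply/seteqP; split => w /=; rewrite -decode_trunc.
have mA' : measurable (decode @^-1` (trunc k @^-1` A)).
  apply: measurableT_preimage; first exact: measurable_decode.
  exact: preimage_trunc_measurable.
transitivity (P (trunc n @^-1` (decode @^-1` (trunc k @^-1` A)))).
  by congr (P _).
transitivity (nu n (trunc n @^-1` (decode @^-1` (trunc k @^-1` A)))).
  exact: PE.
rewrite nuE -E.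
have -> : encode @^-1` (decode @^-1` (trunc k @^-1` A)) = trunc k @^-1` A.
  by apply/seteqP; split => a /=; rewrite encodeK.
by apply/esym/agree_chain => //; rewrite /c /n !leq_max leqnn.
Qed.

End Limit.

(** * Independent samples *)

Section IID.
Variables (R : realType) (Sigma : finType).
Local Notation M := (multiset Sigma).
Local Notation N := (multiset unit).
Variable nu : probability M R.

(** One sequence of naturals stores countably many multisets: an index codes a sample number
    together with a string. *)
Definition coordinate j : option (nat * seq Sigma) := unpickle j.

Definition sample (k : nat) (w : N) : M := fun z => w (nseq (pickle (k, z)) tt).

Definition set_sample k (p : N * M) : N := fun x =>
  if coordinate (size x) is Some (k', z) then
    if k' == k then p.2 z else p.1 x
  else p.1 x.

Lemma measurable_sample k : measurable_fun setT (sample k).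
Proof. by apply: measurable_multiset => z; exact: measurable_eval. Qed.

Lemma measurable_set_sample k : measurable_fun setT (set_sample k).
Proof.
have m1 x : measurable_fun setT (fun p : N * M => p.1 x).
  by apply: measurable_multiset_comp; exact: measurable_fst.
have m2 z : measurable_fun setT (fun p : N * M => p.2 z).
  by apply: measurable_multiset_comp; exact: measurable_snd.
apply: measurable_multiset => x; rewrite /set_sample.
by case: (coordinate _) => [[k' z]|//]; case: (k' == k).
Qed.

Lemma sample_set_same k p : sample k (set_sample k p) = p.2.
Proof.
by apply/funext => z; rewrite /sample /set_sample size_nseq /coordinate pickleK eqxx.
Qed.

Lemma sample_set_other k l p : l != k -> sample l (set_sample k p) = sample l p.1.
Proof.
move=> lk; apply/funext => z.
by rewrite /sample /set_sample size_nseq /coordinate pickleK (negbTE lk).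
Qed.

(** * From finitely many to infinitely many independent samples *)

Section Stages.
Variable stage : nat -> probability N R.
Hypothesis stageS : forall m A, stage m.+1 A = (stage m \x nu)%E (set_sample m @^-1` A).

(** The stages after [a] only overwrite samples numbered [a] and beyond, to which [B] is
    insensitive. *)
Lemma stage_stable a b B : (a <= b)%N -> measurable B ->
  (forall m p, (a <= m)%N -> B (set_sample m p) <-> B p.1) ->
  stage b B = stage a B.
Proof.
move=> ab mB inv; elim: b ab => [|b IH]; first by rewrite leqn0 => /eqP ->.
rewrite leq_eqVlt ltnS => /orP[/eqP -> //|ab].
rewrite stageS -IH//.
have -> : set_sample b @^-1` B = B `*` setT.
  apply/seteqP; split => [p Bp|p [Bp _]]; first by split => //; apply/(inv b p ab).
  exact/(inv b p ab).
by rewrite product_measure1E// [X in (_ * X)%E]probability_setT mule1.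
Qed.

Lemma stage_samples m (A : nat -> set M) : (forall k, measurable (A k)) ->
  stage m (\bigcap_(k in `I_m) (sample k @^-1` A k)) = (\prod_(k < m) nu (A k))%E.
Proof.
move=> mA; elim: m => [|m IH].
  by rewrite II0 bigcap_set0 big_ord0 [LHS]probability_setT.
rewrite stageS.
have -> : set_sample m @^-1` (\bigcap_(k in `I_m.+1) (sample k @^-1` A k)) =
   (\bigcap_(k in `I_m) (sample k @^-1` A k)) `*` A m.
  apply/seteqP; split => [p Bp|p [Bp Ap] k /=].
    split => [k /= km|]; last by have := Bp m (ltnSn m); rewrite /= sample_set_same.
    by have := Bp k (ltnW km); rewrite /= sample_set_other// ltn_eqF.
  rewrite ltnS leq_eqVlt => /orP[/eqP ->|km]; first by rewrite sample_set_same.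
  by rewrite sample_set_other ?ltn_eqF//; exact: Bp.
have mB : measurable (\bigcap_(k in `I_m) (sample k @^-1` A k)).
  apply: bigcap_measurableType => k _.
  by apply: measurableT_preimage => //; exact: measurable_sample.
by rewrite product_measure1E// big_ord_recr -IH.
Qed.

Definition block j := if coordinate j is Some (k, _) then k else 0%N.

(** The first [n] indices involve only samples numbered below [blocks n], so level [n] is final from
    stage [blocks n] on. *)
Definition blocks n := (\max_(j < n) (block j).+1)%N.

Lemma block_lt n j : (j < n)%N -> (block j < blocks n)%N.
Proof. by move=> jn; exact: (leq_bigmax (F := fun j : 'I_n => (block j).+1) (Ordinal jn)). Qed.

Lemma blocks_mono n m : (n <= m)%N -> (blocks n <= blocks m)%N.
Proof.
move=> nm; apply/bigmax_leqP => i _; apply: block_lt.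
exact: leq_trans (ltn_ord i) nm.
Qed.

Lemma trunc_set_sample n k p : (blocks n <= k)%N -> trunc n (set_sample k p) = trunc n p.1.
Proof.
move=> nk; apply/funext => x; rewrite /trunc; case: ltnP => // /block_lt.
rewrite /block /set_sample; case: (coordinate _) => [[k' z]|//] k'n.
by rewrite ltn_eqF//; exact: leq_trans nk.
Qed.

Lemma stage_agree n b : (blocks n <= b)%N -> agree n (stage (blocks n)) (stage b).
Proof.
move=> nb A mA; apply/esym/stage_stable => //; first exact: preimage_trunc_measurable.
by move=> m p nm; rewrite /= trunc_set_sample.
Qed.

(** A sample occupies infinitely many indices, so an event about the first [m] samples need not be
    visible at any level; this map isolates their indices. *)
Definition keep_blocks m (w : N) : N := fun x => if (block (size x) < m)%N then w x else 0%N.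

Lemma measurable_keep_blocks m : measurable_fun setT (keep_blocks m).
Proof.
apply: measurable_multiset => x; rewrite /keep_blocks; case: (_ < m)%N.
  exact: measurable_eval.
exact: measurable_cst.
Qed.

Lemma keep_blocks_set_sample m k p : (m <= k)%N ->
  keep_blocks m (set_sample k p) = keep_blocks m p.1.
Proof.
move=> mk; apply/funext => x; rewrite /keep_blocks; case: ifP => //.
rewrite /block /set_sample; case: (coordinate _) => [[k' z]|//] k'm.
by rewrite ltn_eqF//; exact: leq_trans mk.
Qed.

Lemma keep_blocks_trunc m n w : keep_blocks m (trunc n w) = trunc n (keep_blocks m w).
Proof. by apply/funext => x; rewrite /keep_blocks /trunc; case: ifP; case: ifP. Qed.

Lemma sample_keep_blocks m k w : (k < m)%N -> sample k (keep_blocks m w) = sample k w.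
Proof.
move=> km; apply/funext => z.
by rewrite /sample /keep_blocks /block size_nseq /coordinate pickleK km.
Qed.

(** The limit is controlled one level at a time. Pushing both laws forward along [keep_blocks m] and
    comparing the images at every level reaches all events about the first [m] blocks. *)
Lemma stage_limit : exists P : probability N R, forall m B, measurable B ->
  P (keep_blocks m @^-1` B) = stage m (keep_blocks m @^-1` B).
Proof.
have [|P PE] := @limit_probability_unit R (fun n => stage (blocks n)).
  by move=> k; apply: stage_agree; exact: blocks_mono.
exists P => m.
have mk := measurable_keep_blocks m.
have [P1 P1E] := @pushforward_probability _ _ _ _ _ P _ mk (probability_setT _).
have [P2 P2E] := @pushforward_probability _ _ _ _ _ (stage m) _ mk (probability_setT _).
suff h : same_law P1 P2 by move=> B mB; rewrite -P1E -P2E; exact: h.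
apply: agree_same_law => n A mA; rewrite P1E P2E.
have E : keep_blocks m @^-1` (trunc n @^-1` A) = trunc n @^-1` (keep_blocks m @^-1` A).
  by apply/seteqP; split => w /=; rewrite keep_blocks_trunc.
have mkA : measurable (keep_blocks m @^-1` A) by exact: measurableT_preimage.
(* Stage [b] is late enough to agree with the limit at level [n], and no earlier than stage [m],
   after which the first [m] blocks are frozen. *)
pose b := maxn m (blocks n).
transitivity (stage b (trunc n @^-1` (keep_blocks m @^-1` A))).
  rewrite E; transitivity (stage (blocks n) (trunc n @^-1` (keep_blocks m @^-1` A))).
    exact: PE.
  by apply: stage_agree => //; rewrite leq_maxr.
rewrite -E; apply: stage_stable; first by rewrite leq_maxl.
  by apply: measurableT_preimage => //; exact: preimage_trunc_measurable.
by move=> k p mk'; rewrite /= keep_blocks_set_sample.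
Qed.

End Stages.

Lemma iid_samples : exists P : probability N R,
  forall (s : seq nat) (A : nat -> set M), uniq s -> (forall k, measurable (A k)) ->
  P (\bigcap_(k in [set` s]) (sample k @^-1` A k)) = (\prod_(k <- s) nu (A k))%E.
Proof.
have /choice[next nextE] (q : nat * probability N R) : exists P' : probability N R,
    forall A, P' A = (q.2 \x nu)%E (set_sample q.1 @^-1` A).
  by apply: pushforward_probability; [exact: measurable_set_sample|exact: probability_setT].
pose stage := fix st n : probability N R :=
  if n is m.+1 then next (m, st m) else dirac (@multiset_empty unit).
have stageS m A : stage m.+1 A = (stage m \x nu)%E (set_sample m @^-1` A).
  by rewrite /= nextE.
have [P PE] := @stage_limit stage stageS.
exists P => s A us mA.
pose m := (\max_(k <- s) k.+1)%N.
have sm k : k \in s -> (k < m)%N.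
  by move=> ks; apply: (leq_bigmax_seq (F := fun k => k.+1)).
(* Samples below [m] not listed in [s] get the trivial constraint, which turns [s] into an initial
   segment at the cost of factors 1. *)
pose A' k := if k \in s then A k else setT.
have mA' k : measurable (A' k) by rewrite /A'; case: ifP.
pose B := \bigcap_(k in `I_m) (sample k @^-1` A' k).
have mB : measurable B.
  apply: bigcap_measurableType => k _.
  by apply: measurableT_preimage => //; exact: measurable_sample.
have -> : \bigcap_(k in [set` s]) (sample k @^-1` A k) = keep_blocks m @^-1` B.
  apply/seteqP; split => [w h k /= km|w h k /= ks].
    by rewrite /A'; case: ifP => // ks; rewrite sample_keep_blocks//; exact: h.
  have := h k (sm k ks); rewrite /A' /= ks.
  by rewrite sample_keep_blocks//; exact: sm.
rewrite PE//.
have -> : keep_blocks m @^-1` B = B.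
  by apply/seteqP; split => w h k /= km; have := h k km; rewrite /= sample_keep_blocks.
rewrite stage_samples//.
rewrite (eq_bigr (fun k : 'I_m => if (k : nat) \in s then nu (A k) else 1%E)); last first.
  by move=> k _; rewrite /A'; case: ifP => // _; exact: probability_setT.
rewrite -big_mkcond /= -(big_mkord (fun k => k \in s) (fun k => nu (A k))).
rewrite -big_filter; apply: perm_big; apply: uniq_perm => //.
  by rewrite filter_uniq// iota_uniq.
move=> k; rewrite mem_filter mem_index_iota /=; case: (boolP (k \in s)) => //= /sm.
by [].
Qed.

End IID.

(** * The laws beta . nu *)

Lemma mfun_of_measurable d d' (T : measurableType d) (T' : measurableType d') (f : T -> T') :
  measurable_fun setT f -> exists g : {mfun T >-> T'}, g = f :> (T -> T').
Proof.
move=> mf; pose mfB := isMeasurableFun.Build _ _ _ _ f mf.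
by pose g : {mfun T >-> T'} := HB.pack f mfB; exists g.
Qed.

Section Keys.
Variables (R : realType) (Sigma : finType) (beta : seq Sigma -> nat).

Definition keys (L : seq (seq Sigma)) : seq {x : seq Sigma & 'I_(beta x)} :=
  [seq Tagged (fun x => 'I_(beta x)) i | x <- L, i <- enum 'I_(beta x)].

Lemma mem_keys L k : (k \in keys L) = (tag k \in L).
Proof.
apply/allpairsPdep/idP => [[x [i [xL _ ->]]]//|kL].
exists (tag k), (tagged k); split => //; first by rewrite mem_enum.
by case: k {kL}.
Qed.

Lemma keys_uniq L : uniq L -> uniq (keys L).
Proof.
move=> uL; apply: allpairs_uniq_dep => // [x _|]; first exact: enum_uniq.
by move=> [x i] [y j] _ _.
Qed.

Lemma esum_keys (L : seq (seq Sigma)) (a : {x : seq Sigma & 'I_(beta x)} -> nat) :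
  uniq L -> (forall k, tag k \notin L -> a k = 0%N) ->
  (\esum_(k in [set: {x : seq Sigma & 'I_(beta x)}]) ((a k)%:R%:E : \bar R))%R =
  (\sum_(k <- keys L) a k)%:R%:E.
Proof.
move=> uL aL.
transitivity (\esum_(k in [set` keys L]) ((a k)%:R%:E : \bar R))%R.
  rewrite [RHS]esum_mkcond; apply: eq_esum => k _.
  case: ifPn => //; rewrite notin_setE /= => /negP; rewrite mem_keys => /aL ->.
  by [].
rewrite (esum_fset (finite_seq _)); last by move=> k _; rewrite lee_fin.
by rewrite -fsbig_seq ?keys_uniq// natr_sum -sumEFin.
Qed.

End Keys.

(** * The kernel sending beta to beta . nu *)

Section Dot.
Variables (R : realType) (Sigma : finType).
Local Notation M := (multiset Sigma).
Local Notation N := (multiset unit).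
Local Notation D := (probability M R).

(** [multiset_prefix x a] contains [z] only if [x] is a prefix of [z], so the sum defining beta . nu
    is finite at each string. *)
Definition prefixes (z : seq Sigma) := [seq take j z | j <- iota 0 (size z).+1].

Lemma mem_prefixes x z : (x \in prefixes z) = prefix x z.
Proof.
apply/mapP/idP => [[j _ ->]|/prefixP[y ->]]; first by rewrite prefix_take.
exists (size x); last by rewrite take_size_cat.
by rewrite mem_iota /= add0n ltnS size_cat leq_addr.
Qed.

Lemma prefixes_uniq z : uniq (prefixes z).
Proof.
rewrite map_inj_in_uniq ?iota_uniq// => i j.
rewrite !mem_iota !add0n !ltnS => /andP[_ iz] /andP[_ jz] /(congr1 size).
by rewrite !size_takel.
Qed.

Definition key_index (x : seq Sigma) (i : nat) : nat := pickle (x, i).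

Lemma key_index_inj x i y j : key_index x i = key_index y j -> (x, i) = (y, j).
Proof. exact: (pcan_inj pickleK). Qed.

(* The same samples serve for all beta: joint measurability in (beta, w) then
   makes beta |-> beta . nu a kernel, by Fubini. *)
Definition dot_sum (p : M * N) : M := fun z =>
  (\sum_(x <- prefixes z) \sum_(i < p.1 x)
     sample (key_index x i) p.2 (drop (size x) z))%N.

Lemma measurable_dot_sum : measurable_fun setT dot_sum.
Proof.
apply: measurable_multiset => z; apply: measurable_nat_sum => x.
apply: (measurable_nat_index (f := fun p : M * N => p.1 x)
  (g := fun n (p : M * N) =>
     (\sum_(i < n) sample (key_index x i) p.2 (drop (size x) z))%N)).
  by apply: measurable_multiset_comp; exact: measurable_fst.
move=> n; apply: measurable_nat_sum => i.
apply: (measurable_multiset_comp (f := fun p : M * N => sample (key_index x i) p.2)).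
exact: measurableT_comp (measurable_sample _) measurable_snd.
Qed.

Lemma dot_kernel (nu : D) : exists K : M -> D,
  [/\ forall beta, is_dot beta nu (K beta),
      forall A, measurable A -> measurable_fun setT (fun beta => K beta A) &
      forall mu : D, exists Q : D, forall A, measurable A -> Q A = (\int[mu]_beta K beta A)%E].
Proof.
have [P PE] := iid_samples nu.
have mdot beta : measurable_fun setT (fun w : N => dot_sum (beta, w)).
  exact: (measurableT_comp measurable_dot_sum (measurable_pair1 beta)).
have /choice[K KE] beta : exists K : D,
    forall A, K A = P ((fun w => dot_sum (beta, w)) @^-1` A).
  by apply: pushforward_probability => //; exact: probability_setT.
have KxE beta A : K beta A = P (xsection (dot_sum @^-1` A) beta).
  by rewrite KE; congr (P _); apply/seteqP; split => w /=; rewrite /xsection/= ?inE.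
have mdA A : measurable A -> measurable (dot_sum @^-1` A).
  by move=> mA; apply: measurableT_preimage => //; exact: measurable_dot_sum.
exists K; split; last 2 first.
- move=> A mA; have -> : (fun beta => K beta A) = P \o xsection (dot_sum @^-1` A).
    by apply/funext => beta; rewrite /= KxE.
  exact: (measurable_fun_xsection P (mdA A mA)).
- move=> mu.
  (* The mixture is the image of the product law under [dot_sum]: the product measure is an integral
     of masses of sections. *)
  have [Q QE] := @pushforward_probability _ _ _ _ _ (mu \x P)%E _ measurable_dot_sum (probability_setT _).
  exists Q => A mA; rewrite QE.
  transitivity (\int[mu]_beta P (xsection (dot_sum @^-1` A) beta))%E; first by [].
  by apply: eq_integral => beta _; rewrite KxE.
move=> beta.
pose idx (k : {x : seq Sigma & 'I_(beta x)}) := key_index (tag k) (tagged k).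
have idx_inj : injective idx.
  move=> [x i] [y j] /key_index_inj /= [xy]; move: i j; rewrite xy => i j ij.
  by congr (existT _ y _); exact/val_inj.
pose f k (w : N) : M := multiset_prefix (tag k) (sample (idx k) w).
have mf k : measurable_fun setT (f k).
  apply: measurableT_comp; first exact: measurable_prefix.
  exact: measurable_sample.
have /choice[X XE] k := mfun_of_measurable (mf k).
have [S SE] := mfun_of_measurable (mdot beta).
have sampleE k A : measurable A -> P (sample k @^-1` A) = nu A.
  move=> mA; have := PE [:: k] (fun=> A) isT (fun=> mA).
  by rewrite big_seq1 set_cons1 bigcap_set1.
exists _, N, P, X, S; split.
- move=> k A mA; rewrite /= /distribution /pushforward XE.
  rewrite -[RHS](sampleE (idx k))//.
  by apply: measurableT_preimage => //; exact: measurable_prefix.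
- move=> s A us mA.
  (* [idx] is injective, so constraints on keys become constraints on distinct samples; a number
     that indexes no key gets the trivial constraint. *)
  pose A' j : set M := if pselect (exists k, idx k = j) is left e then
    let k := projT1 (cid e) in multiset_prefix (tag k) @^-1` A k else setT.
  have A'E k : A' (idx k) = multiset_prefix (tag k) @^-1` A k.
    rewrite /A'; case: pselect => [e|[]]; last by exists k.
    by case: (cid e) => k' /= /idx_inj ->.
  have mA' j : measurable (A' j).
    rewrite /A'; case: pselect => // e; apply: measurableT_preimage => //.
    exact: measurable_prefix.
  transitivity (P (\bigcap_(j in [set` map idx s]) (sample j @^-1` A' j))).
    congr (P _); apply/seteqP; split => [w h j /= /mapP[k ks ->]|w h k ks].
      by rewrite A'E; have := h k ks; rewrite /= XE.
    by have := h (idx k) (map_f _ ks); rewrite /= XE A'E.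
  rewrite PE ?map_inj_uniq// big_map; apply: eq_bigr => k _.
  by rewrite XE A'E -(sampleE (idx k))// -A'E.
- apply/aeW => w z; rewrite SE.
  rewrite (@esum_keys R _ _ (prefixes z)) ?prefixes_uniq//.
    rewrite big_allpairs_dep /=; congr (_%:R%:E).
    rewrite /dot_sum big_seq [RHS]big_seq; apply: eq_bigr => x; rewrite mem_prefixes => xz.
    rewrite big_enum /=; apply: eq_bigr => i _.
    by rewrite XE /f /multiset_prefix /= xz.
  by move=> k; rewrite mem_prefixes XE /f /multiset_prefix => /negbTE ->.
- by move=> A mA; rewrite KE /distribution /pushforward SE.
Qed.

End Dot.

Lemma rectangle_measure_unique d1 d2 (T1 : measurableType d1) (T2 : measurableType d2)
    (R : realType) (m1 m2 : {measure set (T1 * T2) -> \bar R}) :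
  (m1 setT < +oo)%E ->
  (forall A B, measurable A -> measurable B -> m1 (A `*` B) = m2 (A `*` B)) ->
  forall C, measurable C -> m1 C = m2 C.
Proof.
move=> m1oo m12.
pose G : set (set (T1 * T2)) :=
  [set C | exists A B, [/\ measurable A, measurable B & C = A `*` B]].
apply: (@measure_unique _ R (T1 * T2)%type G (fun=> setT)).
- rewrite measurable_prod_measurableType; congr (<<s _ >>).
  apply/seteqP; split => [_ [A mA [B mB <-]]|_ [A [B [mA mB ->]]]].
    by exists A, B.
  by exists A => //; exists B.
- move=> _ _ [A [B [mA mB ->]]] [A' [B' [mA' mB' ->]]].
  by exists (A `&` A'), (B `&` B'); split; [exact: measurableI|exact: measurableI|rewrite setXI].
- by move=> _; exists setT, setT; split => //; rewrite setXTT.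
- by rewrite bigcup_const.
- by move=> _ [A [B [mA mB ->]]]; exact: m12.
- by [].
Qed.

(** The points where [f] and [g] differ lie in a measurable null set, up to which each preimage is
    included in the other. *)
Lemma ae_eq_preimage d d' (T : measurableType d) (T' : measurableType d') (R : realType)
    (P : {measure set T -> \bar R}) (f g : T -> T') A :
  measurable_fun setT f -> measurable_fun setT g -> measurable A ->
  {ae P, forall t, f t = g t} -> P (f @^-1` A) = P (g @^-1` A).
Proof.
move=> mf mg mA [N [mN PN0 subN]].
have le (h k : T -> T') : measurable_fun setT h -> measurable_fun setT k ->
    (forall t, ~ N t -> h t = k t) -> (P (h @^-1` A) <= P (k @^-1` A))%E.
  move=> mh mk hk; have mkA := measurableT_preimage mk mA.
  have mhA := measurableT_preimage mh mA.
  apply: (@le_trans _ _ (P (k @^-1` A `|` N))).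
    apply: le_measure; rewrite ?inE//; first exact: measurableU.
    move=> t /= At; have [Nt|Nt] := pselect (N t); first by right.
    by left; rewrite -hk.
  by apply: (le_trans (measureU2 _ mkA mN)); rewrite [X in (_ + X)%E]PN0 adde0.
have E t : ~ N t -> f t = g t.
  by move=> Nt; apply: contrapT => fg; apply: Nt; apply: subN.
by apply/eqP; rewrite eq_le !le// => t /E.
Qed.

Lemma measurable_bigcap_seq d (T : measurableType d) (I : eqType) (t : seq I) (F : I -> set T) :
  (forall k, measurable (F k)) -> measurable (\bigcap_(k in [set` t]) F k).
Proof.
move=> mF; elim: t => [|x t IH].
  by rewrite (_ : \bigcap_(k in _) _ = setT)//; apply/seteqP; split.
rewrite (_ : \bigcap_(k in _) _ = F x `&` \bigcap_(k in [set` t]) F k).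
  exact: measurableI.
apply/seteqP; split => [w h|w [wx wt] k /=].
  by split => [|k /= kt]; apply: h; rewrite /= inE ?eqxx// kt orbT.
by rewrite inE => /orP[/eqP ->//|]; exact: wt.
Qed.

(** * Sums of independent multisets *)

Section IndependentSums.
Variables (R : realType) (Sigma : finType) (I : eqType).
Local Notation M := (multiset Sigma).
Implicit Types (s t : seq I).

Definition image_sum Omega (g : M -> M) (X : I -> Omega -> M) s (w : Omega) : M :=
  fun z => (\sum_(k <- s) g (X k w) z)%N.

Lemma image_sum_cons Omega g (X : I -> Omega -> M) x s w :
  image_sum g X (x :: s) w = multiset_add (g (X x w)) (image_sum g X s w).
Proof. by apply/funext => z; rewrite /image_sum big_cons. Qed.

Lemma measurable_image_sum d (Omega : measurableType d) (g : M -> M)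
    (X : I -> Omega -> M) s : measurable_fun setT g ->
  (forall k, measurable_fun setT (X k)) -> measurable_fun setT (image_sum g X s).
Proof.
move=> mg mX; apply: measurable_multiset => z; apply: measurable_nat_sum => k.
apply: (measurable_multiset_comp (f := fun w => g (X k w))).
exact: measurableT_comp.
Qed.

(* The joint law of an independent family is pinned on the events of t while
   the summands of s are absorbed one at a time into the sum. *)
Lemma independent_sum_law d d' (Omega : measurableType d) (Omega' : measurableType d')
    (P : probability Omega R) (P' : probability Omega' R)
    (X : I -> {RV P >-> M}) (X' : I -> {RV P' >-> M}) (g : M -> M) :
  measurable_fun setT g ->
  mutually_independent X -> mutually_independent X' ->
  (forall k A, measurable A -> P (X k @^-1` (g @^-1` A)) = P' (X' k @^-1` (g @^-1` A))) ->
  forall s t (A : I -> set M) B, uniq (s ++ t) ->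
  (forall k, measurable (A k)) -> measurable B ->
  P (\bigcap_(k in [set` t]) (X k @^-1` (g @^-1` A k)) `&` image_sum g X s @^-1` B) =
  P' (\bigcap_(k in [set` t]) (X' k @^-1` (g @^-1` A k)) `&` image_sum g X' s @^-1` B).
Proof.
move=> mg indX indX' XX'.
have mgA A : measurable A -> measurable (g @^-1` A) by exact: measurableT_preimage.
have mE t (A : I -> set M) : (forall k, measurable (A k)) ->
   measurable (\bigcap_(k in [set` t]) (X k @^-1` (g @^-1` A k))).
  move=> mA; apply: measurable_bigcap_seq => k.
  by apply: measurableT_preimage => //; exact: mgA.
have mE' t (A : I -> set M) : (forall k, measurable (A k)) ->
   measurable (\bigcap_(k in [set` t]) (X' k @^-1` (g @^-1` A k))).
  move=> mA; apply: measurable_bigcap_seq => k.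
  by apply: measurableT_preimage => //; exact: mgA.
elim=> [|x s IH] t A B ust mA mB.
  (* An empty sum is constant, so the event on the sum is trivial or impossible. *)
  have h Om (Y : I -> Om -> M) : image_sum g Y [::] = fun=> @multiset_empty Sigma.
    by apply/funext => w; apply/funext => z; rewrite /image_sum big_nil.
  rewrite !h; have [B0|B0] := pselect (B (@multiset_empty Sigma)).
    rewrite !preimage_cst !mem_set// !setIT.
    rewrite (indX t (fun k => g @^-1` A k))//; last by move=> k; exact: mgA.
    rewrite (indX' t (fun k => g @^-1` A k))//; last by move=> k; exact: mgA.
    by apply: eq_bigr => k _; exact: XX'.
  by rewrite !preimage_cst !memNset// !setI0 !measure0.
pose h w := (g (X x w), image_sum g X s w).
pose h' w := (g (X' x w), image_sum g X' s w).
have mh : measurable_fun setT h.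
  apply: measurable_fun_pair; first exact: measurableT_comp.
  exact: measurable_image_sum.
have mh' : measurable_fun setT h'.
  apply: measurable_fun_pair; first exact: measurableT_comp.
  exact: measurable_image_sum.
pose mp := measure_function_pushforward__canonical__measure_function_Measure.
(* Joint law of the next summand and the remaining sum, restricted to the event on [t]; equality on
   rectangles suffices. *)
pose Q := mp _ _ _ _ R (mrestr P (mE t A mA)) h mh.
pose Q' := mp _ _ _ _ R (mrestr P' (mE' t A mA)) h' mh'.
pose C := [set p : M * M | B (multiset_add p.1 p.2)].
have mC : measurable C.
  apply: (@measurableT_preimage _ _ (M * M)%type M
    (fun p => multiset_add p.1 p.2) B) => //.
  by apply: measurable_add; [exact: measurable_fst|exact: measurable_snd].
have QC : Q C = Q' C.
  apply: rectangle_measure_unique => //.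
    rewrite /Q /= /pushforward /mrestr.
    apply: le_lt_trans (probability_le1 P _) _; last exact: ltry.
    by apply: measurableI; [rewrite preimage_setT; exact: measurableT|apply: (mE t A mA)].
  move=> A1 B1 mA1 mB1; rewrite /Q /Q' /= /pushforward /mrestr.
  (* The condition [A1] on summand [x] joins those on [t], so the induction hypothesis applies with
     [x :: t]. *)
  pose A' k := if k == x then A1 else A k.
  have mA' k : measurable (A' k) by rewrite /A'; case: ifP.
  have xt : x \notin t.
    by move: ust; rewrite /= mem_cat negb_or -andbA => /and3P[_ + _].
  have E Om (Y : I -> Om -> M) :
    (fun w => (g (Y x w), image_sum g Y s w)) @^-1` (A1 `*` B1) `&`
      (\bigcap_(k in [set` t]) (Y k @^-1` (g @^-1` A k))) =
    \bigcap_(k in [set` x :: t]) (Y k @^-1` (g @^-1` A' k)) `&` image_sum g Y s @^-1` B1.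
    apply/seteqP; split => [w [[/= w1 w2] wt]|w [wt w2]].
      split => // k /=; rewrite inE => /orP[/eqP ->|kt]; first by rewrite /A' eqxx.
      rewrite /A'; case: eqP => [kx|_]; first by move: xt; rewrite -kx kt.
      exact: wt.
    split; first by split => //; have := wt x (mem_head _ _); rewrite /= /A' eqxx.
    move=> k kt; have := wt k; rewrite /= inE kt orbT /A' => /(_ isT).
    by case: eqP => // kx; move: xt; rewrite -kx kt.
  rewrite !E; apply: IH => //.
  by rewrite -[x :: t]cat1s uniq_catCA.
have F Om (Y : I -> Om -> M) : image_sum g Y (x :: s) @^-1` B =
    (fun w => (g (Y x w), image_sum g Y s w)) @^-1` C.
  by apply/seteqP; split => w /=; rewrite /C /= image_sum_cons.
by rewrite !F setIC [in RHS]setIC.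
Qed.

End IndependentSums.

(** * Nonexpansiveness of beta . nu and of bind *)

Section DotAgreement.
Variables (R : realType) (Sigma : finType).
Local Notation M := (multiset Sigma).
Local Notation D := (probability M R).

Lemma prefix_law_agree n x (nu nu' : D) : agree (n - size x) nu nu' ->
  agree n (prefix_law x nu) (prefix_law x nu').
Proof.
move=> h A mA; rewrite /prefix_law /pushforward.
have -> : (multiset_prefix x : M -> M) @^-1` (trunc n @^-1` A) =
    trunc (n - size x) @^-1` ((multiset_prefix x : M -> M) @^-1` (trunc n @^-1` A)).
  by apply/seteqP; split => a /=; rewrite -trunc_prefix.
apply: h; apply: measurableT_preimage; first exact: measurable_prefix.
exact: preimage_trunc_measurable.
Qed.

Lemma prefix_law_support d (Omega : measurableType d) (P : probability Omega R)
    (X : {RV P >-> M}) x (nu : D) z : same_law (distribution P X) (prefix_law x nu) ->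
  {ae P, forall w, ~~ prefix x z -> X w z = 0%N}.
Proof.
move=> h; have [xz|xz] := boolP (prefix x z); first exact: aeW.
pose B := [set a : M | a z != 0%N].
have mB : measurable B.
  by apply: (measurable_nat_preimage (f := fun a : M => a z) [set n | n != 0%N]);
    exact: measurable_eval.
exists (X @^-1` B); split.
- exact: measurableT_preimage.
- transitivity (distribution P X B); first by [].
  rewrite h// /prefix_law /pushforward (_ : _ @^-1` B = set0) ?measure0//.
  by apply/seteqP; split => a //=; rewrite /B /multiset_prefix /= (negbTE xz).
- by move=> w /= Xw; apply/negP => /eqP Xwz; apply: Xw => _.
Qed.

Lemma strings_uniq n : uniq (strings Sigma n).
Proof. by rewrite map_inj_uniq ?enum_uniq//; exact: val_inj. Qed.

(** A summand of tag [x] almost surely contains only extensions of [x], so below level [n] only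
    finitely many keys contribute. *)
Lemma trunc_dot_sum n d (Omega : measurableType d) (P : probability Omega R)
    (beta : M) (nu : D) (X : {x : seq Sigma & 'I_(beta x)} -> {RV P >-> M})
    (S : {RV P >-> M}) :
  (forall k, same_law (distribution P (X k)) (prefix_law (tag k) nu)) ->
  {ae P, forall omega, forall z : seq Sigma,
    ((S omega z)%:R%:E : \bar R)
    = (\esum_(k in [set: {x : seq Sigma & 'I_(beta x)}])
         ((X k omega z)%:R%:E : \bar R))%R} ->
  {ae P, forall w, trunc n (S w) =
    image_sum (trunc n) (fun k => X k : Omega -> M) (keys beta (strings Sigma n)) w}.
Proof.
move=> XE SE.
(* Keys and strings are countable, so a single null set serves for all pairs of them. *)
have aeX : {ae P, forall w, forall j : nat,
    if (unpickle j : option ({x : seq Sigma & 'I_(beta x)} * seq Sigma)) is Some (k, z)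
    then ~~ prefix (tag k) z -> X k w z = 0%N else True}.
  apply: ae_foralln => j; case: unpickle => [[k z]|]; last exact: aeW.
  exact: prefix_law_support (XE k).
apply: filterS2 SE aeX => w Sw Xw; apply/funext => z.
rewrite /image_sum /trunc; case: ltnP => zn; last by rewrite big1.
have := Sw z; rewrite (@esum_keys R _ _ (strings Sigma n)) ?strings_uniq//.
  by move=> [] /eqP; rewrite eqr_nat => /eqP ->.
move=> k kn; have := Xw (pickle (k, z)); rewrite pickleK; apply.
by apply: contra kn => /size_prefix; rewrite mem_strings => /leq_trans; apply; exact: ltnW.
Qed.

(** Below level [n] both laws come from finite sums of independent truncated summands over the same
    keys. Every tag has length at least [l], and prefixing by it gains that many levels. *)
Lemma dot_agree n l (beta : M) (nu nu' la la' : D) :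
  is_dot beta nu la -> is_dot beta nu' la' ->
  (forall z, (size z < l)%N -> beta z = 0%N) ->
  agree (n - l) nu nu' -> agree n la la'.
Proof.
move=> [d [Om [P [X [S [XE indX SE laE]]]]]] [d' [Om' [P' [X' [S' [XE' indX' SE' laE']]]]]].
move=> bl nn A mA.
have mtA := preimage_trunc_measurable n mA.
rewrite laE// laE'//.
pose Y := keys beta (strings Sigma n).
have red dd (O : measurableType dd) (p : probability O R)
    (Z : {x : seq Sigma & 'I_(beta x)} -> {RV p >-> M}) (T : {RV p >-> M}) :
  {ae p, forall w, trunc n (T w) = image_sum (trunc n) (fun k => Z k : O -> M) Y w} ->
  distribution p T (trunc n @^-1` A) =
    p (image_sum (trunc n) (fun k => Z k : O -> M) Y @^-1` A).
  move=> h; apply: (ae_eq_preimage (f := fun w => trunc n (T w))) => //.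
    by apply: measurableT_comp => //; exact: measurable_trunc.
  by apply: measurable_image_sum => //; exact: measurable_trunc.
rewrite (red _ _ _ _ _ (trunc_dot_sum n XE SE)) (red _ _ _ _ _ (trunc_dot_sum n XE' SE')).
have mt := @measurable_trunc Sigma n.
have := @independent_sum_law R Sigma _ _ _ _ _ P P' X X' _ mt indX indX' _ Y [::]
  (fun=> setT) A.
rewrite cats0.
have E Om0 (F : {x : seq Sigma & 'I_(beta x)} -> set Om0) : \bigcap_(k in [set` [::]]) F k = setT.
  by apply/seteqP; split.
rewrite !E !setTI; apply => //; last by rewrite keys_uniq// strings_uniq.
move=> k B mB; have mtB := preimage_trunc_measurable n mB.
transitivity (prefix_law (tag k) nu (trunc n @^-1` B)); first exact: XE.
transitivity (prefix_law (tag k) nu' (trunc n @^-1` B)); last exact/esym/XE'.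
apply: prefix_law_agree => //; apply: (agree_le _ nn).
(* A key of tag [x] exists only if [beta x] is positive, whence [l <= size x]. *)
rewrite leq_sub2l// leqNgt; apply/negP => /bl b0.
by case: k => x [i ilt] /= in b0 *; rewrite b0 in ilt.
Qed.

Lemma bind_agree n l (mu mu' nu nu' la la' : D) :
  is_bind mu nu la -> is_bind mu' nu' la' -> same_law mu mu' ->
  agree l mu (\d_(@multiset_empty Sigma)) -> agree (n - l) nu nu' -> agree n la la'.
Proof.
move=> [K [Kdot KE]] [K' [Kdot' KE']] mm ml nn A mA.
have mtA := preimage_trunc_measurable n mA.
(* The kernels given by [is_bind] come without measurability; at level [n] they take the same values
   as the measurable kernels of [dot_kernel]. *)
have [K0 [K0dot mK0 _]] := dot_kernel nu.
have [K0' [K0dot' mK0' _]] := dot_kernel nu'.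
have KK0 b : K b (trunc n @^-1` A) = K0 b (trunc n @^-1` A).
  exact: (@dot_agree n 0 _ _ _ _ _ (Kdot b) (K0dot b)).
have KK0' b : K' b (trunc n @^-1` A) = K0' b (trunc n @^-1` A).
  exact: (@dot_agree n 0 _ _ _ _ _ (Kdot' b) (K0dot' b)).
rewrite KE// KE'//.
transitivity (\int[mu]_b K0 b (trunc n @^-1` A))%E; first exact: eq_integral.
transitivity (\int[mu']_b K0' b (trunc n @^-1` A))%E; last exact/esym/eq_integral.
rewrite (eq_measure_integral mu'); last by move=> B mB _; exact: mm.
apply: ae_eq_integral => //; [exact: mK0|exact: mK0'|].
(* As [trunc l] empties the strings of length at least [l], the event says that no string shorter
   than [l] occurs. It has mass 1 under [mu'], and on it [dot_agree] gains [l] levels. *)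
pose E := [set b : M | multiset_eqn l (@multiset_empty Sigma) b].
have mE : measurable (trunc l @^-1` E).
  by apply: preimage_trunc_measurable; exact: measurable_class.
exists (~` (trunc l @^-1` E)); split; first exact: measurableC.
  rewrite [LHS](probability_setC mu' mE) -[X in (_ - X)%E](mm _ mE).
  rewrite [X in (_ - X)%E](ml _ (measurable_class _ _)) diracE mem_set ?subee//.
  by move=> z _; rewrite /trunc; case: ifP.
move=> b /= + Eb; apply=> _.
apply: (@dot_agree n l _ _ _ _ _ (K0dot b) (K0dot' b)) => // z zl.
by have := Eb z (ltnW zl); rewrite /trunc zl.
Qed.

End DotAgreement.

(** * Nonexpansiveness, fixed points and existence for the operations *)

Section Operations.
Variables (R : realType) (Sigma : finType).
Local Notation M := (multiset Sigma).
Local Notation D := (probability M R).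
Local Notation zero := (@multiset_empty Sigma).

Definition dirac_empty : D := \d_zero.

(** The truncation of a sum depends only on the truncated summands, and on rectangles of truncated
    pairs the product measures agree factor by factor. *)
Lemma par_agree n (mu mu' nu nu' : D) : agree n mu mu' -> agree n nu nu' ->
  agree n (par_law mu nu) (par_law mu' nu').
Proof.
move=> hmu hnu A mA; rewrite /par_law /pushforward.
have mt := @measurable_trunc Sigma n.
pose h (p : M * M) := (trunc n p.1, trunc n p.2).
have mh : measurable_fun setT h.
  by apply: measurable_fun_pair; apply: measurableT_comp => //.
pose mp := measure_function_pushforward__canonical__measure_function_Measure.
pose Q := mp _ _ _ _ R (mu \x nu)%E h mh.
pose Q' := mp _ _ _ _ R (mu' \x nu')%E h mh.
pose C := [set p : M * M | A (trunc n (multiset_add p.1 p.2))].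
have mC : measurable C.
  apply: (@measurableT_preimage _ _ (M * M)%type M
    (fun p => trunc n (multiset_add p.1 p.2)) A) => //.
  apply: measurableT_comp => //.
  by apply: measurable_add; [exact: measurable_fst|exact: measurable_snd].
have -> : (fun p : M * M => multiset_add p.1 p.2 : M) @^-1` (trunc n @^-1` A) = h @^-1` C.
  by apply/seteqP; split => p; rewrite /C /= !trunc_add !trunc_trunc.
have QC : Q C = Q' C; last exact: QC.
apply: rectangle_measure_unique => //.
  by rewrite /Q /= /pushforward preimage_setT [X in (X < _)%E](probability_setT (mu \x nu)%E) ltry.
move=> A1 B1 mA1 mB1; rewrite /Q /Q' /= /pushforward.
have -> : h @^-1` (A1 `*` B1) = (trunc n @^-1` A1) `*` (trunc n @^-1` B1) by [].
have mtA := preimage_trunc_measurable n mA1.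
have mtB := preimage_trunc_measurable n mB1.
transitivity (mu (trunc n @^-1` A1) * nu (trunc n @^-1` B1))%E.
  exact: product_measure1E.
by rewrite hmu// hnu//; apply/esym/product_measure1E.
Qed.

(** The Dirac mass at the empty multiset is reproduced by &, by choice and by bind; with
    nonexpansiveness, agreement with it then propagates through expressions. *)
Lemma par_dirac_empty : same_law (par_law dirac_empty dirac_empty) dirac_empty.
Proof.
move=> A mA; rewrite /par_law /pushforward.
pose B : set (M * M) := (fun p : M * M => multiset_add p.1 p.2 : M) @^-1` A.
have mB : measurable B.
  apply: measurableT_preimage => //.
  by apply: measurable_add; [exact: measurable_fst|exact: measurable_snd].
transitivity (\int[dirac_empty]_a dirac_empty (xsection B a))%E; first by [].
rewrite integral_dirac//; last exact: (measurable_fun_xsection dirac_empty mB).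
rewrite diracT mul1e /= /dirac_empty /= !diracE; congr (_%:R%:E); congr nat_of_bool.
by rewrite mem_xsection; apply/idP/idP => /set_mem h; exact/mem_set.
Qed.

Lemma choice_agree n r (mu mu' nu nu' : D) : agree n mu mu' -> agree n nu nu' ->
  agree n (choice_law r mu nu) (choice_law r mu' nu').
Proof. by move=> h1 h2 A mA; rewrite /choice_law h1// h2. Qed.

Lemma choice_dirac_empty r : same_law (choice_law r dirac_empty dirac_empty) dirac_empty.
Proof.
move=> A mA; rewrite /choice_law /dirac_empty /= diracE -!EFinM -EFinD -mulrDl.
by rewrite addrC subrK mul1r.
Qed.

Lemma dot_dirac_empty beta : is_dot beta dirac_empty dirac_empty.
Proof.
have [Z ZE] := mfun_of_measurable (@measurable_cst _ _ M M setT zero).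
exists _, M, dirac_empty, (fun=> Z), Z; split.
- move=> k A mA; rewrite /distribution /prefix_law /pushforward ZE /dirac_empty /= !diracE.
  have prefix0 x : multiset_prefix x zero = zero.
    by apply/funext => z; rewrite /multiset_prefix; case: ifP.
  by congr (_%:R%:E); congr nat_of_bool; apply/idP/idP; rewrite !inE /= /cst prefix0.
- move=> s A us mA; elim: s us => [_|k s IH /= /andP[_ us]].
    rewrite big_nil (_ : \bigcap_(i in _) _ = setT); last by apply/seteqP; split.
    exact: probability_setT.
  rewrite big_cons -IH//.
  rewrite (_ : \bigcap_(i in [set` k :: s]) _ =
    Z @^-1` A k `&` \bigcap_(i in [set` s]) (Z @^-1` A i)); last first.
    apply/seteqP; split => [w h|w [wx wt] j /=].
      by split => [|j /= js]; apply: h; rewrite /= inE ?eqxx// js orbT.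
    by rewrite inE => /orP[/eqP ->//|]; exact: wt.
  rewrite ZE preimage_cst; case: ifP => _; last by rewrite set0I !measure0 mul0e.
  by rewrite setTI [X in (X * _)%E](probability_setT dirac_empty) mul1e.
- by apply: aeW => w z; rewrite ZE esum1// => k _.
- move=> A mA; rewrite /distribution /pushforward ZE /dirac_empty /= !diracE.
  by congr (_%:R%:E); congr nat_of_bool; apply/idP/idP; rewrite !inE.
Qed.

Lemma bind_dirac_empty (mu : D) : is_bind mu dirac_empty dirac_empty.
Proof.
exists (fun=> dirac_empty); split => [beta|A mA]; first exact: dot_dirac_empty.
by rewrite integral_cst// [X in (_ * X)%E](probability_setT mu) mule1.
Qed.

(** The iterates stabilize level by level and have a limit [P]. At level [n.+1], both [P] and
    [Phi P] agree with iterate [n.+1]. *)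
Lemma contraction_fixpoint (Phi : D -> D) :
  (forall n (mu mu' : D), agree n mu mu' -> agree n.+1 (Phi mu) (Phi mu')) ->
  exists mu : D, same_law mu (Phi mu).
Proof.
move=> contr; pose mu k := iter k Phi dirac_empty.
have [|P PE] := @limit_probability R Sigma mu.
  by elim=> [|k IH]; [exact: agree0|exact: contr].
exists P; apply: agree_same_law => -[|n]; first exact: agree0.
apply: (agree_trans (PE n.+1)); apply: contr; apply: agree_sym; exact: PE.
Qed.

Lemma par_exists (mu nu : D) : exists la : D, same_law la (par_law mu nu).
Proof.
have madd : measurable_fun setT (fun p : M * M => multiset_add p.1 p.2 : M).
  by apply: measurable_add; [exact: measurable_fst|exact: measurable_snd].
have [la laE] := @pushforward_probability _ _ _ _ _ (mu \x nu)%E _ madd (probability_setT _).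
by exists la => A mA; rewrite laE.
Qed.

Lemma choice_exists r (mu nu : D) : exists la : D, same_law la (choice_law r mu nu).
Proof.
have r0 : 0 <= r%:num by [].
have s0 : 0 <= 1 - r%:num by rewrite subr_ge0.
pose m1 : {measure set M -> \bar R} := mscale (NngNum r0) mu.
pose m2 : {measure set M -> \bar R} := mscale (NngNum s0) nu.
pose m : {measure set M -> \bar R} := measure_add m1 m2.
have mE A : m A = choice_law r mu nu A by exact: (measure_addE m1 m2 A).
have [|la laE] := @probability_of_measure _ M R m.
  rewrite mE /choice_law [X in (_ * X + _)%E](probability_setT mu).
  by rewrite [X in (_ + _ * X)%E](probability_setT nu) !mule1 -EFinD addrC subrK.
by exists la => A mA; rewrite laE mE.
Qed.

Lemma bind_exists (mu nu : D) : exists la : D, is_bind mu nu la.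
Proof.
have [K [Kdot _ Kint]] := dot_kernel nu.
by have [la laE] := Kint mu; exists la, K.
Qed.

End Operations.

(** * Semantics of expressions *)

Section Semantics.
Variables (R : realType) (Sigma : finType) (Var : eqType).
Local Notation M := (multiset Sigma).
Local Notation D := (probability M R).
Local Notation preexpr := (preexpr R Sigma Var).
Local Notation env := (env R Sigma Var).
Implicit Types (e : preexpr) (rho : env) (F G : preexpr -> env -> D).

Definition clause F e : Prop := forall rho,
  match e with
  | Ref x => same_law (F e rho) (rho x)
  | Letter a => same_law (F e rho) (\d_(multiset_single [:: a]))
  | Par e1 e2 => same_law (F e rho) (par_law (F e1 rho) (F e2 rho))
  | Oplus r e1 e2 => same_law (F e rho) (choice_law r (F e1 rho) (F e2 rho))
  | Seq e1 e2 => is_bind (F e1 rho) (F e2 rho) (F e rho)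
  | Fix x e1 => same_law (F e rho) (F e1 (rebind rho x (F e rho)))
  | Skip => same_law (F e rho) (\d_(multiset_single [::]))
  | Fail => same_law (F e rho) (\d_(@multiset_empty Sigma))
  end.

(** The equations are required at the subexpressions of [e] only, so that structural induction runs
    on raw terms without constraining ill-formed ones. *)
Fixpoint sem_on F e : Prop :=
  clause F e /\
  match e with
  | Par e1 e2 | Oplus _ e1 e2 | Seq e1 e2 => sem_on F e1 /\ sem_on F e2
  | Fix _ e1 => sem_on F e1
  | _ => True
  end.

Lemma sem_on_clause F e : sem_on F e -> clause F e.
Proof. by case: e => [?|?|? ?|? ? ?|? ?|? ?||] []. Qed.

Lemma var_paths_notin y e : y \notin free_vars e -> var_paths y e = [::].
Proof.
elim: e => //= [x|e1 IH1 e2 IH2|r e1 IH1 e2 IH2|e1 IH1 e2 IH2|x e1 IH1].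
- by rewrite inE eq_sym => /negbTE ->.
- by rewrite mem_cat negb_or => /andP[/IH1 -> /IH2 ->].
- by rewrite mem_cat negb_or => /andP[/IH1 -> /IH2 ->].
- rewrite mem_cat negb_or => /andP[/IH1 -> /IH2 ->] /=.
  by elim: (exit_paths e1).
- by rewrite mem_filter negb_and negbK; case: eqVneq.
Qed.

Lemma closed_var_paths y e : closed_expr e -> var_paths y e = [::].
Proof. by move=> /nilP e0; apply: var_paths_notin; rewrite e0. Qed.

(** A capped minimum: if no path is shorter than [n], any [l >= n] is as good as infinity for
    agreement at level [n]. *)
Lemma shortest_path (L : seq (seq Sigma)) n : exists l,
  (forall u, u \in L -> (l <= size u)%N) /\
  ((n <= l)%N \/ exists2 u, u \in L & size u = l).
Proof.
elim: L => [|v L [l [lL H]]]; first by exists n; split => //; left.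
have [vl|lv] := leqP (size v) l.
  exists (size v); split; last by right; exists v; rewrite ?mem_head.
  by move=> u; rewrite inE => /orP[/eqP -> //|/lL]; exact: leq_trans.
exists l; split; first by move=> u; rewrite inE => /orP[/eqP ->|/lL//]; exact: ltnW.
case: H => [nl|[u uL ul]]; first by left.
by right; exists u => //; rewrite inE uL orbT.
Qed.

Lemma agree_sub n l k (mu nu : D) : ((n <= l)%N \/ agree (n - (l + k)) mu nu) ->
  agree (n - l - k) mu nu.
Proof.
move=> [nl|]; last by rewrite subnDA.
by move: nl; rewrite -subn_eq0 => /eqP ->; exact: agree0.
Qed.

(* Agreement with dirac_empty at level l says that, almost surely, no string
   shorter than l occurs. *)
Lemma exit_paths_support F e l rho : well_formed e -> sem_on F e ->
  (forall u, u \in exit_paths e -> (l <= size u)%N) ->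
  (forall y w, w \in var_paths y e -> agree (l - size w) (rho y) (@dirac_empty R Sigma)) ->
  agree l (F e rho) (@dirac_empty R Sigma).
Proof.
elim: e l rho => [x|a|e1 IH1 e2 IH2|r e1 IH1 e2 IH2|e1 IH1 e2 IH2|x e1 IH1||] l rho wf sem ex vp;
  have := sem_on_clause sem rho => cl.
- apply: (agree_trans (same_law_agree l cl)).
  by have := vp x [::]; rewrite /= eqxx subn0; apply; exact: mem_head.
- apply: (agree_trans (same_law_agree l cl)).
  have l1 : (l <= 1)%N by apply: (ex [:: a]); exact: mem_head.
  have E : trunc l (multiset_single [:: a]) = trunc l (@multiset_empty Sigma).
    apply/funext => z; rewrite /trunc; case: ltnP => // zl.
    have /size0nil -> : size z = 0%N by apply/eqP; rewrite -leqn0 -ltnS (leq_trans zl).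
    by [].
  move=> A mA; rewrite /dirac_empty /= !diracE; congr (_%:R%:E); congr nat_of_bool.
  by apply/idP/idP => /set_mem h; apply/mem_set; move: h; rewrite /= E.
- case/andP: wf => wf1 wf2; case: sem => _ [s1 s2].
  apply: (agree_trans (same_law_agree l cl)).
  apply: agree_trans (same_law_agree l (@par_dirac_empty R Sigma)).
  apply: par_agree.
  + apply: IH1 => // [u ue|y w we]; first by apply: ex; rewrite /= mem_cat ue.
    by apply: vp; rewrite /= mem_cat we.
  + apply: IH2 => // [u ue|y w we]; first by apply: ex; rewrite /= mem_cat ue orbT.
    by apply: vp; rewrite /= mem_cat we orbT.
- case/andP: wf => wf1 wf2; case: sem => _ [s1 s2].
  apply: (agree_trans (same_law_agree l cl)).
  apply: agree_trans (same_law_agree l (@choice_dirac_empty R Sigma r)).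
  apply: choice_agree.
  + apply: IH1 => // [u ue|y w we]; first by apply: ex; rewrite /= mem_cat ue.
    by apply: vp; rewrite /= mem_cat we.
  + apply: IH2 => // [u ue|y w we]; first by apply: ex; rewrite /= mem_cat ue orbT.
    by apply: vp; rewrite /= mem_cat we orbT.
- case/and3P: wf => c1 wf1 wf2; case: sem => _ [s1 s2].
  (* A shortest exit path of [e1] bounds from below the strings it produces; followed by a path in
     [e2] it is a path of the composition. *)
  have [l1 [l1e H]] := shortest_path (exit_paths e1) l.
  apply: (@bind_agree R Sigma l l1 _ _ _ _ _ _ cl (bind_dirac_empty (F e1 rho))) => //.
    by apply: IH1 => // y w; rewrite closed_var_paths.
  apply: IH2 => // [v ve|y w we].
    case: H => [ll1|[u ue <-]]; first by move: ll1; rewrite -subn_eq0 => /eqP ->.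
    by rewrite leq_subLR -size_cat; apply: ex; apply/allpairsP; exists (u, v).
  apply: agree_sub; case: H => [ll1|[u ue <-]]; [by left|right].
  rewrite -size_cat; apply: vp; rewrite /= mem_cat; apply/orP; right.
  by apply/allpairsP; exists (u, w).
- case/andP: wf => pr wf1; case: sem => _ s1.
  (* Induction on the level: by productivity the occurrences of [x] lie behind a letter, so level
     [j.+1] of the body needs only level [j] of the fixed point. *)
  have h j : (j <= l)%N -> agree j (F (Fix x e1) rho) (@dirac_empty R Sigma).
    elim: j => [|j IHj] jl; first exact: agree0.
    apply: (agree_trans (same_law_agree j.+1 cl)).
    apply: IH1 => // [u ue|y w we]; first exact: leq_trans jl (ex u ue).
    rewrite /rebind; case: eqP => [yx|/eqP yx].
      apply: agree_le (IHj (ltnW jl)).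
      have /allP /(_ w) := pr; rewrite -yx => /(_ we).
      by case: w {we} => // b w _; rewrite /= subSS leq_subr.
    apply: agree_le (vp y w _); first exact: leq_sub2r.
    by rewrite /= eq_sym (negbTE yx).
  exact: h.
- have := ex [::] (mem_head _ _); rewrite leqn0 => /eqP ->; exact: agree0.
- exact: same_law_agree.
Qed.

(** Two semantics and two environments are compared at once: this serves uniqueness, compatibility
    with [same_law], and the contraction property behind fixed points. *)
Lemma semantics_agree F G e n rho rho' : well_formed e -> sem_on F e -> sem_on G e ->
  (forall y w, w \in var_paths y e -> agree (n - size w) (rho y) (rho' y)) ->
  agree n (F e rho) (G e rho').
Proof.
elim: e n rho rho' => [x|a|e1 IH1 e2 IH2|r e1 IH1 e2 IH2|e1 IH1 e2 IH2|x e1 IH1||]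
  n rho rho' wf semF semG vp;
  have := sem_on_clause semF rho => clF; have := sem_on_clause semG rho' => clG.
- apply: (agree_trans (same_law_agree n clF)).
  apply: (agree_trans _ (agree_sym (same_law_agree n clG))).
  by have := vp x [::]; rewrite /= eqxx subn0; apply; exact: mem_head.
- exact: (agree_trans (same_law_agree n clF) (agree_sym (same_law_agree n clG))).
- case/andP: wf => wf1 wf2; case: semF semG => _ [f1 f2] [_ [g1 g2]].
  apply: (agree_trans (same_law_agree n clF)).
  apply: (agree_trans _ (agree_sym (same_law_agree n clG))).
  apply: par_agree; [apply: IH1|apply: IH2] => // y w we;
    by apply: vp; rewrite /= mem_cat we ?orbT.
- case/andP: wf => wf1 wf2; case: semF semG => _ [f1 f2] [_ [g1 g2]].
  apply: (agree_trans (same_law_agree n clF)).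
  apply: (agree_trans _ (agree_sym (same_law_agree n clG))).
  apply: choice_agree; [apply: IH1|apply: IH2] => // y w we;
    by apply: vp; rewrite /= mem_cat we ?orbT.
- case/and3P: wf => c1 wf1 wf2; case: semF semG => _ [f1 f2] [_ [g1 g2]].
  (* The composition gains the length of a shortest exit of [e1]; prefixing a path in [e2] with this
     exit gives a path of the composition that accounts for the remaining level. *)
  have [l [le H]] := shortest_path (exit_paths e1) n.
  apply: (@bind_agree R Sigma n l _ _ _ _ _ _ clF clG).
  + by apply: agree_same_law => m; apply: IH1 => // y w; rewrite closed_var_paths.
  + by apply: exit_paths_support => // y w; rewrite closed_var_paths.
  + apply: IH2 => // y w we.
    apply: agree_sub; case: H => [ll1|[u ue <-]]; [by left|right].
    rewrite -size_cat; apply: vp; rewrite /= mem_cat; apply/orP; right.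
    by apply/allpairsP; exists (u, w).
- case/andP: wf => pr wf1; case: semF semG => _ f1 [_ g1].
  have h j : (j <= n)%N -> agree j (F (Fix x e1) rho) (G (Fix x e1) rho').
    elim: j => [|j IHj] jn; first exact: agree0.
    apply: (agree_trans (same_law_agree j.+1 clF)).
    apply: (agree_trans _ (agree_sym (same_law_agree j.+1 clG))).
    apply: IH1 => // y w we; rewrite /rebind; case: eqP => [yx|/eqP yx].
      apply: agree_le (IHj (ltnW jn)).
      have /allP /(_ w) := pr; rewrite -yx => /(_ we).
      by case: w {we} => // b w _; rewrite /= subSS leq_subr.
    apply: agree_le (vp y w _); first exact: leq_sub2r.
    by rewrite /= eq_sym (negbTE yx).
  exact: h.
- exact: (agree_trans (same_law_agree n clF) (agree_sym (same_law_agree n clG))).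
- exact: (agree_trans (same_law_agree n clF) (agree_sym (same_law_agree n clG))).
Qed.

Lemma semantics_same_law F G e rho rho' : well_formed e -> sem_on F e -> sem_on G e ->
  (forall y, same_law (rho y) (rho' y)) -> same_law (F e rho) (G e rho').
Proof.
move=> wf f g h; apply: agree_same_law => n; apply: semantics_agree => // y w _.
exact: same_law_agree.
Qed.

Lemma semantics_exists : exists F, forall e, well_formed e -> sem_on F e.
Proof.
have /choice[par parE] (p : D * D) := par_exists p.1 p.2.
have /choice[ch chE] (p : {i01 R} * (D * D)) := choice_exists p.1 p.2.1 p.2.2.
have /choice[bind bindE] (p : D * D) := bind_exists p.1 p.2.
(* [fixp] is total, with an arbitrary law for a map without fixed point. The semantics is then a
   plain structural recursion, and productivity enters only its verification. *)
have /choice[fixp fixpE] (Phi : D -> D) : exists mu : D,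
    (exists mu' : D, same_law mu' (Phi mu')) -> same_law mu (Phi mu).
  have [[mu h]|h] := pselect (exists mu' : D, same_law mu' (Phi mu')); first by exists mu.
  by exists (@dirac_empty R Sigma) => /h.
pose F := fix sem e : env -> D := match e with
  | Ref x => fun rho => rho x
  | Letter a => fun rho => \d_(multiset_single [:: a])
  | Par e1 e2 => fun rho => par (sem e1 rho, sem e2 rho)
  | Oplus r e1 e2 => fun rho => ch (r, (sem e1 rho, sem e2 rho))
  | Seq e1 e2 => fun rho => bind (sem e1 rho, sem e2 rho)
  | Fix x e1 => fun rho => fixp (fun mu => sem e1 (rebind rho x mu))
  | Skip => fun rho => \d_(multiset_single [::])
  | Fail => fun rho => \d_(@multiset_empty Sigma)
  end.
exists F; elim=> [x|a|e1 IH1 e2 IH2|r e1 IH1 e2 IH2|e1 IH1 e2 IH2|x e1 IH1||] //=.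
- move=> /andP[/IH1 s1 /IH2 s2]; split => // rho; exact: (parE (F e1 rho, F e2 rho)).
- move=> /andP[/IH1 s1 /IH2 s2]; split => // rho; exact: (chE (r, (F e1 rho, F e2 rho))).
- move=> /and3P[_ /IH1 s1 /IH2 s2]; split => // rho; exact: (bindE (F e1 rho, F e2 rho)).
- move=> /andP[pr wf1]; have s1 := IH1 wf1; split => // rho.
  apply: (fixpE (fun mu => F e1 (rebind rho x mu))); apply: contraction_fixpoint.
  (* The environments differ only at [x], and every path to [x] is nonempty, which gains one
     level. *)
  move=> n mu mu' h; apply: semantics_agree => // y w we.
  rewrite /rebind; case: eqP => [yx|_]; last exact: agree_refl.
  apply: agree_le h; have /allP /(_ w) := pr; rewrite -yx => /(_ we).
  by case: w {we} => // b w _; rewrite /= subSS leq_subr.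
Qed.

(** A dummy value on ill-formed terms makes [sem_on] applicable to a semantics of well-formed
    expressions. *)
Definition extend (G : expr R Sigma Var -> env -> D) : preexpr -> env -> D :=
  fun e => if insub e is Some e' then G e' else fun=> @dirac_empty R Sigma.

Lemma extendE (G : expr R Sigma Var -> env -> D) (e : expr R Sigma Var) :
  extend G (val e) = G e.
Proof. by rewrite /extend valK. Qed.

Lemma sem_on_extend (G : expr R Sigma Var -> env -> D) e :
  is_semantics G -> well_formed e -> sem_on (extend G) e.
Proof.
move=> [_ semG].
elim: e => [x|a|e1 IH1 e2 IH2|r e1 IH1 e2 IH2|e1 IH1 e2 IH2|x e1 IH1||] wf;
  pose e' : expr R Sigma Var := Sub _ wf; have E := extendE G e'.
- split => // rho; rewrite [extend G _]E; have [[_ _ _ h] _] := semG rho; exact: h.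
- split => // rho; rewrite [extend G _]E; have [[_ _ h _] _] := semG rho; exact: h.
- have /= /andP[wf1 wf2] := wf; split; last by split; [exact: IH1|exact: IH2].
  move=> rho; have [_ [_ h _ _]] := semG rho.
  have := h e' (Sub e1 wf1) (Sub e2 wf2) erefl.
  by rewrite -!extendE.
- have /= /andP[wf1 wf2] := wf; split; last by split; [exact: IH1|exact: IH2].
  move=> rho; have [_ [h _ _ _]] := semG rho.
  have := h e' (Sub e1 wf1) (Sub e2 wf2) r erefl.
  by rewrite -!extendE.
- have /= /and3P[_ wf1 wf2] := wf; split; last by split; [exact: IH1|exact: IH2].
  move=> rho; have [_ [_ _ h _]] := semG rho.
  have := h e' (Sub e1 wf1) (Sub e2 wf2) erefl.
  by rewrite -!extendE.
- have /= /andP[_ wf1] := wf; split; last exact: IH1.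
  move=> rho; have [_ [_ _ _ h]] := semG rho.
  have := h e' x (Sub e1 wf1) erefl.
  by rewrite -!extendE.
- split => // rho; rewrite [extend G _]E; have [[h _ _ _] _] := semG rho; exact: h.
- split => // rho; rewrite [extend G _]E; have [[_ h _ _] _] := semG rho; exact: h.
Qed.

End Semantics.

Theorem theorem5p9 (R : realType) (Sigma : finType) (Var : eqType) :
  exists F : expr R Sigma Var -> env R Sigma Var -> probability (multiset Sigma) R,
    is_semantics F /\
    (forall G : expr R Sigma Var -> env R Sigma Var ->
                probability (multiset Sigma) R,
       is_semantics G -> forall e rho, same_law (G e rho) (F e rho)).
Proof.
have [F semF] := semantics_exists R Sigma Var.
have clF (e : expr R Sigma Var) : clause F (val e) by apply/sem_on_clause/semF/valP.
exists (fun e => F (val e)); split; last first.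
  move=> G semG e rho; rewrite -extendE.
  by apply: semantics_same_law; [exact: valP|apply: sem_on_extend => //; exact: valP|
    exact/semF/valP|].
split; first by move=> e rho rho' h; apply: semantics_same_law => //;
  [exact: valP|exact/semF/valP|exact/semF/valP].
move=> rho; split; split.
- by move=> e E; have := clF e rho; rewrite E.
- by move=> e E; have := clF e rho; rewrite E.
- by move=> e a E; have := clF e rho; rewrite E.
- by move=> e x E; have := clF e rho; rewrite E.
- by move=> e e1 e2 r E; have := clF e rho; rewrite E.
- by move=> e e1 e2 E; have := clF e rho; rewrite E.
- by move=> e e1 e2 E; have := clF e rho; rewrite E.
- by move=> e x e1 E; have := clF e rho; rewrite E.
Qed.
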